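(* Let $g \in L^2(\mathbb{R}^d)$ be an arbitrary window function. If $\mathcal{L} \subseteq \mathbb{R}^{2d}$ satisfies $\mathcal{L} \subseteq S(\mathbb{R}^d \times \Lambda)=\{S(x,\lambda):x\in\mathbb{R}^d,\lambda\in\Lambda\}$ for some symplectic matrix $S \in \mathrm{Sp}_{2d}(\mathbb{R})$ and some lattice $\Lambda \subseteq \mathbb{R}^d$, then the set $$\mathcal{N}(g,\mathcal{L}) = \{ f \in L^2(\mathbb{R}^d) : \exists h \in L^2(\mathbb{R}^d) \text{ with } h \nsim f \text{ and } |V_gf(z)| = |V_gh(z)| \ \forall z\in\mathcal{L} \}$$ contains an infinite-dimensional cone.
   Context: $V_gf(x,\omega)=\int_{\mathbb{R}^d} f(t)\overline{g(t-x)}e^{-2\pi i \omega\cdot t}\,dt$ is the short-time Fourier transform. For functions $f,h$, $f\sim h$ means there is $\nu\in\mathbb{C}$, $|\nu|=1$, with $f=\nu h$; $f\nsim h$ means this fails. A lattice in $\mathbb{R}^d$ is $A\mathbb{Z}^d$ with $A\in\mathrm{GL}_d(\mathbb{R})$. $\mathrm{Sp}_{2d}(\mathbb{R})=\{S\in\mathrm{GL}_{2d}(\mathbb{R}):S^T\mathcal{J}S=\mathcal{J}\}$ with $\mathcal{J}=\begin{pmatrix}0&-I_d\\ I_d&0\end{pmatrix}$. A cone in a vector space $V$ is a set $C\subseteq V$ with $\kappa C\subseteq C$ for all $\kappa>0$; it is infinite-dimensional if it is not contained in any finite-dimensional subspace of $V$. *)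

(* Defs.v *)
From HB Require Import structures.
From mathcomp Require Import all_boot all_order all_algebra.
From mathcomp Require Import all_classical all_reals all_analysis.
From mathcomp.real_closed Require Export complex.
Export Order.TTheory GRing.Theory Num.Theory.

Set Implicit Arguments.
Unset Strict Implicit.
Unset Printing Implicit Defensive.

Local Open Scope ring_scope.
Local Open Scope classical_set_scope.

Section Defs.
Variable R : realType.

Definition cons_cV (n : nat) (x : R) (t : 'cV[R]_n) : 'cV[R]_n.+1 :=
  \col_(i < n.+1) match unlift ord0 i with Some j => t j ord0 | None => x end.

(* identification of n-tuples (which carry the product = Borel sigma-algebra
   in MathComp-Analysis) with column vectors *)
Definition cV_of_tuple (n : nat) (t : n.-tuple R) : 'cV[R]_n :=
  \col_(i < n) tnth t i.

Definition Rn_measurable (n : nat) (A : set 'cV[R]_n) : Prop :=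
  measurable [set t : n.-tuple R | A (cV_of_tuple t)].

Definition Rn_measurable_fun (n : nat) (F : 'cV[R]_n -> R) : Prop :=
  measurable_fun setT (fun t : n.-tuple R => F (cV_of_tuple t)).

(* Lebesgue integral on R^n of a nonnegative [0,+oo]-valued function,
   computed as the iterated integral (Tonelli) w.r.t. Lebesgue measure on R. *)
Fixpoint Rn_int (n : nat) : ('cV[R]_n -> \bar R) -> \bar R :=
  match n with
  | 0 => fun F => F 0
  | n'.+1 => fun F =>
      (\int[@lebesgue_measure R]_x Rn_int (fun t => F (cons_cV x t)))%E
  end.

(* Lebesgue integral on R^n of an integrable real function,
   computed as the iterated integral (Fubini). *)
Fixpoint Rn_Rint (n : nat) : ('cV[R]_n -> R) -> R :=
  match n with
  | 0 => fun F => F 0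
  | n'.+1 => fun F =>
      Rintegral (@lebesgue_measure R) setT (fun x => Rn_Rint (fun t => F (cons_cV x t)))
  end.

Definition Rn_leb (n : nat) (A : set 'cV[R]_n) : \bar R :=
  Rn_int (fun x => (\1_A x)%:E).

Definition Rn_cint (n : nat) (F : 'cV[R]_n -> R[i]) : R[i] :=
  (Rn_Rint (fun t => complex.Re (F t)) +i* Rn_Rint (fun t => complex.Im (F t)))%C.

Definition sqmod (z : R[i]) : R := complex.Re z ^+ 2 + complex.Im z ^+ 2.

Definition L2 (n : nat) (f : 'cV[R]_n -> R[i]) : Prop :=
  [/\ Rn_measurable_fun (fun t => complex.Re (f t)),
      Rn_measurable_fun (fun t => complex.Im (f t)) &
      (Rn_int (fun t => (sqmod (f t))%:E) < +oo)%E].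

Definition ae_eq (n : nat) (f h : 'cV[R]_n -> R[i]) : Prop :=
  exists N : set 'cV[R]_n,
    [/\ Rn_measurable N, Rn_leb N = 0%E & forall x, ~ N x -> f x = h x].

Definition equiv_phase (n : nat) (f h : 'cV[R]_n -> R[i]) : Prop :=
  exists nu : R[i], `|nu| = 1 /\ ae_eq f (fun t => nu * h t).

Definition dotR (n : nat) (u v : 'cV[R]_n) : R := \sum_(i < n) u i ord0 * v i ord0.

Definition expi (theta : R) : R[i] := (cos theta +i* sin theta)%C.

Definition stft (d : nat) (g f : 'cV[R]_d -> R[i]) (z : 'cV[R]_(d + d)) : R[i] :=
  let x := usubmx z in
  let omega := dsubmx z in
  Rn_cint (fun t => f t * conjc (g (t - x)) * expi (- (2 * pi * dotR omega t))).

Definition is_lattice (d : nat) (Lam : set 'cV[R]_d) : Prop :=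
  exists A : 'M[R]_d, A \in unitmx /\
    Lam = [set A *m map_mx (fun k : int => k%:~R) kk | kk in [set: 'cV[int]_d]].

Definition Jmx (d : nat) : 'M[R]_(d + d) :=
  block_mx 0 (- 1%:M) 1%:M 0.

Definition symplectic (d : nat) (S : 'M[R]_(d + d)) : Prop :=
  S \in unitmx /\ S^T *m Jmx d *m S = Jmx d.

Definition Nset (d : nat) (g : 'cV[R]_d -> R[i]) (L : set 'cV[R]_(d + d))
  : set ('cV[R]_d -> R[i]) :=
  [set f | L2 f /\ exists h, [/\ L2 h, ~ equiv_phase h f &
             forall z, L z -> `|stft g f z| = `|stft g h z| ]].

Definition is_cone (d : nat) (C : set ('cV[R]_d -> R[i])) : Prop :=
  forall (kappa : R) f, 0 < kappa -> C f -> C (fun t => kappa%:C%C * f t).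

Definition infinite_dimensional (d : nat) (C : set ('cV[R]_d -> R[i])) : Prop :=
  forall (m : nat) (b : 'I_m -> 'cV[R]_d -> R[i]), (forall i, L2 (b i)) ->
    exists2 f, C f &
      ~ exists c : 'I_m -> R[i], ae_eq f (fun t => \sum_(i < m) c i * b i t).

End Defs.

(* Main.v *)
(* Write pi(w) phi (t) = e^{- i pi a.b} e^{2 i pi b.t} phi(t - a) for w = (a, b)
   and R g (t) = g(- t).  Substituting t -> x + a - t in the integral defining
   V = V_g(pi(w) R g)(x, omega) gives V = e^{- 2 i pi omega.x} conj(V) as soon as
   b.x - a.omega is an integer.  If w = S(k0, 0) with k0 in the dual lattice of
   Lambda, the symplecticity of S makes this phase an integer for all
   (x, omega) in L, and for all multiples of w.  So no metaplectic operator is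
   needed: the functions R g + i pi(w)^n R g and R g - i pi(w)^n R g have the
   same spectrogram on L, and n >= 1 and positive scalars give the cone.
   Since pi(w) has no eigenvector in L^2, factoring polynomials over C shows that
   the functions pi(w)^n R g are linearly independent, which yields both the
   infinite dimension and the non-equivalence. If g = 0 almost everywhere, any
   nonzero function of L^2 can play the role of R g. *)
Require Import Defs.
From HB Require Import structures.
From mathcomp Require Import all_boot all_order all_algebra.
From mathcomp Require Import all_classical all_reals all_analysis.
From mathcomp.real_closed Require Import complex.
From mathcomp Require Import measurable_realfun ring lra.

Set Implicit Arguments.
Unset Strict Implicit.
Unset Printing Implicit Defensive.

Local Open Scope ring_scope.
Local Open Scope classical_set_scope.

Import numFieldNormedType.Exports.

(** * Lebesgue measure on R^n *)

Definition tuple_of_cV (R : realType) (n : nat) (v : 'cV[R]_n) : n.-tuple R :=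
  [tuple v i ord0 | i < n].

Lemma cV_of_tupleK (R : realType) n : cancel (@cV_of_tuple R n) (@tuple_of_cV R n).
Proof. by move=> t; apply: eq_from_tnth => i; rewrite tnth_mktuple mxE. Qed.

Lemma tuple_of_cVK (R : realType) n : cancel (@tuple_of_cV R n) (@cV_of_tuple R n).
Proof. by move=> v; apply/colP => i; rewrite mxE tnth_mktuple. Qed.

Lemma cV_of_tuple_cons (R : realType) n (x : R) (t : n.-tuple R) :
  cV_of_tuple [tuple of x :: t] = cons_cV x (cV_of_tuple t).
Proof.
apply/colP => i; rewrite !mxE; case: unliftP => [j|] -> /=.
  by rewrite tnthS mxE.
by rewrite (tnth_nth 0).
Qed.

Definition cons_pair (R : realType) n (p : measurableTypeR R * n.-tuple R) : n.+1.-tuple R :=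
  [tuple of (p.1 : R) :: p.2].

Lemma measurable_cons_pair (R : realType) n : measurable_fun setT (@cons_pair R n).
Proof. by apply: measurable_cons. Qed.

(** [R] and [measurableTypeR R], the carrier of Lebesgue measure, have the same measurable sets
    under two structures; unfolding measurability passes from one to the other. *)
Lemma measurable_thead (R : realType) n :
  measurable_fun setT (fun t : n.+1.-tuple R => (thead t : measurableTypeR R)).
Proof.
have h : measurable_fun setT (fun t : n.+1.-tuple R => thead t : R).
  exact: measurable_tnth.
by move=> _ Y mY; exact: h.
Qed.

Section cons_measure.
Context (R : realType) (n : nat).
Variable m : {sigma_finite_measure set (n.-tuple R) -> \bar R}.

(** Iterated integrals come with no measure on the whole space. This adds one coordinate to a given
    measure, so that Lebesgue measure on tuples is built by recursion and the theorems of Tonelli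
    and Fubini apply. *)
Definition cons_measure : set (n.+1.-tuple R) -> \bar R :=
  pushforward (@lebesgue_measure R \x m)%E (@cons_pair R n).

Let pushforward_cons_pair : {measure set (n.+1.-tuple R) -> \bar R} :=
  measure_function_pushforward__canonical__measure_function_Measure
    (@lebesgue_measure R \x m)%E (@measurable_cons_pair R n).

HB.instance Definition _ := Measure.copy cons_measure pushforward_cons_pair.

(* The instance declared on [_ \x _] by the library for sigma-finite measures is
   shadowed by the one for subprobabilities, whence the explicit exhaustion. *)
Lemma cons_measure_sigma_finite : sigma_finite setT cons_measure.
Proof.
have /sigma_finiteP[A [UA ndA mA]] := sigma_finiteT (@lebesgue_measure R).
have /sigma_finiteP[B [UB ndB mB]] := sigma_finiteT m.
pose F k : set (measurableTypeR R * n.-tuple R) := A k `*` B k.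
have UF : [set: measurableTypeR R * n.-tuple R] = \bigcup_k F k.
  apply/seteqP; split => [[x y] _|//].
  have : [set: measurableTypeR R] x by [].
  rewrite UA => -[i _ Ai]; have : [set: n.-tuple R] y by [].
  rewrite UB => -[j _ Bj]; exists (maxn i j) => //; split => /=.
    by have /subsetPset := ndA _ _ (leq_maxl i j); exact.
  by have /subsetPset := ndB _ _ (leq_maxr i j); exact.
have mF k : measurable (F k) /\ ((@lebesgue_measure R \x m) (F k) < +oo)%E.
  have [mAk Ak] := mA k; have [mBk Bk] := mB k.
  split; first exact: measurableX.
  by rewrite product_measure1E// lte_mul_pinfty// ge0_fin_numE.
pose g (t : n.+1.-tuple R) : measurableTypeR R * n.-tuple R :=
  (thead t : measurableTypeR R, [tuple of behead t]).
have mg : measurable_fun setT g.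
  by apply: measurable_fun_pair; [exact: measurable_thead|exact: measurable_behead].
have gK : cancel (@cons_pair R n) g.
  by move=> [x t]; congr pair => /=; apply: val_inj.
exists (fun k => g @^-1` F k).
  by rewrite -preimage_bigcup -UF preimage_setT.
move=> k; have [mFk Fk] := mF k; split.
  by rewrite -[X in measurable X]setTI; exact: mg.
rewrite /cons_measure /pushforward -comp_preimage (_ : g \o _ = id) //.
by apply/funext => p /=; rewrite gK.
Qed.

HB.instance Definition _ :=
  @Measure_isSigmaFinite.Build _ _ _ cons_measure cons_measure_sigma_finite.
End cons_measure.

Fixpoint Rn_measure (R : realType) (n : nat) :
    {sigma_finite_measure set (n.-tuple R) -> \bar R} :=
  match n with
  | 0 => \d_([tuple] : 0.-tuple R)
  | n'.+1 => cons_measure (Rn_measure R n')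
  end.

(** Tonelli, one coordinate at a time. This is the bridge from iterated integrals to genuine
    integrals. *)
Lemma Rn_int_measure (R : realType) n (F : 'cV[R]_n -> \bar R) :
  measurable_fun setT (fun t : n.-tuple R => F (cV_of_tuple t)) -> (forall t, 0 <= F t)%E ->
  Rn_int F = (\int[Rn_measure R n]_t F (cV_of_tuple t))%E.
Proof.
elim: n F => [|n IH] F mF F0 /=.
  rewrite integral_dirac//= diracT mul1e; congr F.
  by apply/colP => -[].
have mFc : measurable_fun setT
    (fun p : measurableTypeR R * n.-tuple R => F (cV_of_tuple (cons_pair p))).
  exact: (measurableT_comp mF (@measurable_cons_pair R n)).
rewrite ge0_integral_pushforward//; last exact: measurable_cons_pair.
rewrite preimage_setT.
transitivity (\int[@lebesgue_measure R \x Rn_measure R n]_p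
    F (cV_of_tuple (cons_pair p)))%E; last by [].
rewrite fubini_tonelli1//.
apply: eq_integral => x _; rewrite /fubini_F IH //.
  by apply: eq_integral => t _ /=; rewrite cV_of_tuple_cons.
have := measurableT_comp mFc (pair1_measurable (x : measurableTypeR R)).
by apply: eq_measurable_fun => t _ /=; rewrite cV_of_tuple_cons.
Qed.

(** * Reflections and iterated integrals *)

(** Uniqueness of Lebesgue measure: the reflection turns an interval closed on the right into one
    closed on the left, of the same length. *)
Lemma lebesgue_measure_reflect (R : realType) (c : R) (A : set R) : measurable A ->
  @lebesgue_measure R [set x | A (c - x)] = @lebesgue_measure R A.
Proof.
move=> mA.
have mr : measurable_fun setT (fun x : measurableTypeR R => (c - x : measurableTypeR R)).
  have h : measurable_fun setT (fun x : R => c - x) by exact: measurable_funB.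
  by move=> _ Y mY; exact: h.
pose nu : {measure set (measurableTypeR R) -> \bar R} :=
  measure_function_pushforward__canonical__measure_function_Measure
    (@lebesgue_measure R) mr.
apply/esym; rewrite (@lebesgue_measure_unique R nu _ A mA)// => _ [[a b]] _ <-.
rewrite /nu /= /pushforward.
rewrite (_ : _ @^-1` _ = `[c - b, c - a[%classic); last first.
  apply/seteqP; split=> x /=; rewrite !in_itv/=; lra.
rewrite !lebesgue_measure_itv/= !lte_fin ltrD2l ltrN2.
by case: ifP => // _; rewrite -!EFinB; congr EFin; ring.
Qed.

Lemma integral_reflect (R : realType) (c : R) (f : R -> \bar R) :
  measurable_fun setT f -> (forall x, 0 <= f x)%E ->
  (\int[@lebesgue_measure R]_x f (c - x)%R = \int[@lebesgue_measure R]_x f x)%E.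
Proof.
move=> mf f0.
have mr : measurable_fun setT (fun x : measurableTypeR R => (c - x : measurableTypeR R)).
  have h : measurable_fun setT (fun x : R => c - x) by exact: measurable_funB.
  by move=> _ Y mY; exact: h.
have := @ge0_integral_pushforward _ _ _ _ R _ mr (@lebesgue_measure R) setT f measurableT mf.
rewrite preimage_setT => <-; last by move=> x _; exact: f0.
by apply: eq_measure_integral => A mA _; rewrite -[RHS](lebesgue_measure_reflect c mA).
Qed.

(** Positive and negative parts are reflected separately, so the case of infinite integrals is
    covered too. *)
Lemma Rintegral_reflect (R : realType) (c : R) (f : R -> R) :
  measurable_fun setT f ->
  Rintegral (@lebesgue_measure R) setT (fun x => f (c - x)) =
  Rintegral (@lebesgue_measure R) setT f.
Proof.
move=> mf; rewrite /Rintegral; congr fine.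
have mEf : measurable_fun setT (EFin \o f) by exact/measurable_EFinP.
rewrite integralE [RHS]integralE; congr (_ - _)%E.
  rewrite (funepos_comp (EFin \o f) (fun x => c - x)).
  by rewrite -(integral_reflect c (measurable_funepos mEf)).
rewrite (funeneg_comp (EFin \o f) (fun x => c - x)).
by rewrite -(integral_reflect c (measurable_funeneg mEf)).
Qed.

Lemma cons_cVK (R : realType) n (v : 'cV[R]_n.+1) :
  cons_cV (v ord0 ord0) (\col_i v (lift ord0 i) ord0) = v.
Proof. by apply/colP => i; rewrite !mxE; case: unliftP => [j|] ->; rewrite ?mxE. Qed.

Lemma sub_cons_cV (R : realType) n (v : 'cV[R]_n.+1) x t :
  v - cons_cV x t = cons_cV (v ord0 ord0 - x) (\col_i v (lift ord0 i) ord0 - t).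
Proof. by apply/colP => i; rewrite !mxE; case: unliftP => [j|] ->; rewrite ?mxE. Qed.

Lemma measurable_Rn_int d (T : measurableType d) (R : realType) n
    (F : T -> 'cV[R]_n -> \bar R) :
  measurable_fun setT (fun p : T * n.-tuple R => F p.1 (cV_of_tuple p.2)) ->
  (forall y t, 0 <= F y t)%E -> measurable_fun setT (fun y => Rn_int (F y)).
Proof.
move=> mF F0.
have := measurable_fun_fubini_tonelli_F (m2 := Rn_measure R n) _ mF (fun p => F0 _ _).
apply: eq_measurable_fun => y _; rewrite Rn_int_measure//.
exact: (measurableT_comp mF (pair1_measurable y)).
Qed.

(** Moves the first integration variable into the parameter space, which is how the induction on the
    dimension proceeds. *)
Lemma measurable_fun_cons d (T : measurableType d) d' (U : measurableType d')
    (R : realType) n (F : T -> 'cV[R]_n.+1 -> U) :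
  measurable_fun setT (fun p : T * n.+1.-tuple R => F p.1 (cV_of_tuple p.2)) ->
  measurable_fun setT (fun p : (T * measurableTypeR R) * n.-tuple R =>
    F p.1.1 (cons_cV p.1.2 (cV_of_tuple p.2))).
Proof.
move=> mF.
have mg : measurable_fun setT (fun p : (T * measurableTypeR R) * n.-tuple R =>
    (p.1.1, cons_pair (p.1.2, p.2))).
  apply: measurable_fun_pair; first exact: measurableT_comp.
  apply: measurableT_comp; first exact: measurable_cons_pair.
  by apply: measurable_fun_pair => //; exact: measurableT_comp.
have := measurableT_comp mF mg.
by apply: eq_measurable_fun => p _ /=; rewrite cV_of_tuple_cons.
Qed.

(* Holds without integrability: an iterated integral of an integrable function
   takes junk values on a null set of outer variables, and discarding them
   requires the junk to be measurable. *)
Lemma measurable_Rn_Rint d (T : measurableType d) (R : realType) n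
    (F : T -> 'cV[R]_n -> R) :
  measurable_fun setT (fun p : T * n.-tuple R => F p.1 (cV_of_tuple p.2)) ->
  measurable_fun setT (fun y => Rn_Rint (F y)).
Proof.
elim: n d T F => [|n IH] d T F mF /=.
  have := measurableT_comp mF (pair2_measurable ([tuple] : 0.-tuple R)).
  by apply: eq_measurable_fun => y _ /=; congr F; apply/colP => -[].
have mG := IH _ (T * measurableTypeR R)%type
  (fun p t => F p.1 (cons_cV p.2 t)) (measurable_fun_cons mF).
set G := fun p : _ => _ in mG.
have mEG : measurable_fun setT (EFin \o G) by exact/measurable_EFinP.
apply: (@measurableT_comp _ _ _ _ _ _ fine) => //.
have -> : (fun y => \int[@lebesgue_measure R]_x (G (y, x))%:E)%E =
   (fun y => fubini_F (@lebesgue_measure R) (EFin \o G)^\+ y -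
             fubini_F (@lebesgue_measure R) (EFin \o G)^\- y)%E.
  apply/funext => y; rewrite integralE /fubini_F.
  rewrite (funepos_comp (EFin \o G) (pair y)).
  by rewrite (funeneg_comp (EFin \o G) (pair y)).
apply: emeasurable_funB; apply: measurable_fun_fubini_tonelli_F => //.
  exact: measurable_funepos.
exact: measurable_funeneg.
Qed.

Definition sub_tuple (R : realType) n (v : 'cV[R]_n) (t : n.-tuple R) : n.-tuple R :=
  tuple_of_cV (v - cV_of_tuple t).

Lemma measurable_sub_tuple (R : realType) n (v : 'cV[R]_n) : measurable_fun setT (sub_tuple v).
Proof.
apply/measurable_fun_tnthP => i.
have : measurable_fun setT (fun t : n.-tuple R => v i ord0 - tnth t i).
  by apply: measurable_funB => //; exact: measurable_tnth.
by apply: eq_measurable_fun => t _ /=; rewrite tnth_mktuple !mxE.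
Qed.

Lemma measurable_reflect d (U : measurableType d) (R : realType) n (v : 'cV[R]_n)
    (F : 'cV[R]_n -> U) :
  measurable_fun setT (fun t : n.-tuple R => F (cV_of_tuple t)) ->
  measurable_fun setT (fun t : n.-tuple R => F (v - cV_of_tuple t)).
Proof.
move=> mF; have := measurableT_comp mF (measurable_sub_tuple v).
by apply: eq_measurable_fun => t _ /=; rewrite tuple_of_cVK.
Qed.

Lemma measurable_uncons d (U : measurableType d) (R : realType) n
    (F : 'cV[R]_n.+1 -> U) :
  measurable_fun setT (fun t : n.+1.-tuple R => F (cV_of_tuple t)) ->
  measurable_fun setT (fun p : measurableTypeR R * n.-tuple R =>
    F (cons_cV p.1 (cV_of_tuple p.2))).
Proof.
move=> mF; have := measurableT_comp mF (@measurable_cons_pair R n).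
by apply: eq_measurable_fun => t _ /=; rewrite cV_of_tuple_cons.
Qed.

Lemma measurable_cons_cV d (U : measurableType d) (R : realType) n
    (F : 'cV[R]_n.+1 -> U) x :
  measurable_fun setT (fun t : n.+1.-tuple R => F (cV_of_tuple t)) ->
  measurable_fun setT (fun t : n.-tuple R => F (cons_cV x (cV_of_tuple t))).
Proof.
move=> /measurable_uncons mF.
exact: (measurableT_comp mF (pair1_measurable (x : measurableTypeR R))).
Qed.

(** The outer variable is reflected on the line, the remaining ones by induction. The first step
    requires the inner integral to be measurable in the outer variable. *)
Lemma Rn_int_reflect (R : realType) n (v : 'cV[R]_n) (F : 'cV[R]_n -> \bar R) :
  measurable_fun setT (fun t : n.-tuple R => F (cV_of_tuple t)) ->
  (forall t, 0 <= F t)%E -> Rn_int (fun t => F (v - t)) = Rn_int F.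
Proof.
elim: n v F => [|n IH] v F mF F0 /=.
  by congr F; apply/colP => -[].
pose G x := Rn_int (fun t => F (cons_cV x t)).
have mG : measurable_fun setT (G : measurableTypeR R -> \bar R).
  exact: (@measurable_Rn_int _ (measurableTypeR R) R n
    (fun x t => F (cons_cV x t)) (measurable_uncons mF)).
rewrite -[RHS](@integral_reflect R (v ord0 ord0) G); last 2 first.
- by move=> _ Y mY; exact: mG.
- by move=> x; rewrite /G Rn_int_measure ?integral_ge0//; exact: (measurable_cons_cV _ mF).
apply: eq_integral => x _; rewrite /G.
rewrite -[RHS](IH (\col_i v (lift ord0 i) ord0)) //; last exact: (measurable_cons_cV _ mF).
by congr Rn_int; apply/funext => t; rewrite sub_cons_cV.
Qed.

(** Stated for measurable [F] because the induction passes through every slice, and a slice of an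
    integrable function may fail to be integrable. *)
Lemma Rn_Rint_reflect (R : realType) n (v : 'cV[R]_n) (F : 'cV[R]_n -> R) :
  measurable_fun setT (fun t : n.-tuple R => F (cV_of_tuple t)) ->
  Rn_Rint (fun t => F (v - t)) = Rn_Rint F.
Proof.
elim: n v F => [|n IH] v F mF /=.
  by congr F; apply/colP => -[].
pose G x := Rn_Rint (fun t => F (cons_cV x t)).
have mG : measurable_fun setT (G : measurableTypeR R -> R).
  exact: (@measurable_Rn_Rint _ (measurableTypeR R) R n
    (fun x t => F (cons_cV x t)) (measurable_uncons mF)).
rewrite -[RHS](@Rintegral_reflect R (v ord0 ord0) G); last first.
  by move=> _ Y mY; exact: mG.
apply: eq_Rintegral => x _; rewrite /G.
rewrite -[RHS](IH (\col_i v (lift ord0 i) ord0)) //; last exact: (measurable_cons_cV _ mF).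
by congr Rn_Rint; apply/funext => t; rewrite sub_cons_cV.
Qed.

Lemma Rn_Rint_measure (R : realType) n (F : 'cV[R]_n -> R) :
  (Rn_measure R n).-integrable setT (fun t => (F (cV_of_tuple t))%:E) ->
  Rn_Rint F = Rintegral (Rn_measure R n) setT (fun t => F (cV_of_tuple t)).
Proof.
elim: n F => [|n IH] F iF /=.
  rewrite /Rintegral integral_dirac//=; last by case/integrableP: iF.
  by rewrite indicT mul1r; congr F; apply/colP => -[].
have mF : measurable_fun setT (fun t : n.+1.-tuple R => F (cV_of_tuple t)).
  by apply/measurable_EFinP; case/integrableP: iF.
have mFu := measurable_uncons mF.
have mEFu : measurable_fun setT (fun p : measurableTypeR R * n.-tuple R =>
    (F (cons_cV p.1 (cV_of_tuple p.2)))%:E) by exact/measurable_EFinP.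
have iFu : (@lebesgue_measure R \x Rn_measure R n)%E.-integrable setT
    (fun p : measurableTypeR R * n.-tuple R => (F (cons_cV p.1 (cV_of_tuple p.2)))%:E).
  apply/integrableP; split => //.
  have /integrableP[mEF] := iF; rewrite /= ge0_integral_pushforward//.
  - rewrite preimage_setT; under eq_integral do rewrite /= cV_of_tuple_cons; exact.
  - exact: measurable_cons_pair.
  - by apply/measurable_EFinP; apply: (measurableT_comp _ mF).
rewrite /Rintegral integral_pushforward//; first last.
- rewrite preimage_setT; apply: eq_integrable iFu => // p _ /=.
  by rewrite cV_of_tuple_cons.
- by case/integrableP: iF.
- exact: measurable_cons_pair.
rewrite preimage_setT.
transitivity (fine (\int[@lebesgue_measure R \x Rn_measure R n]_p
    (F (cons_cV p.1 (cV_of_tuple p.2)))%:E)%E); last first.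
  by congr fine; apply: eq_integral => p _ /=; rewrite cV_of_tuple_cons.
rewrite -integral12_prod_meas1//; congr fine.
have mG : measurable_fun setT (fun x : measurableTypeR R => Rn_Rint (fun t => F (cons_cV x t))).
  exact: (@measurable_Rn_Rint _ (measurableTypeR R) R n
    (fun x t => F (cons_cV x t)) mFu).
(* Only almost every slice is integrable, and the induction hypothesis speaks of those alone; the
   outer integrands therefore agree almost everywhere. *)
apply: ae_eq_integral => //.
- exact/measurable_EFinP.
- exact: (measurable_fubini_F iFu).
apply: filterS (ae_integrable1 iFu) => x /= ix _.
rewrite IH//= /Rintegral fineK//; exact: integrable_fin_num.
Qed.

(** * Square-integrable functions *)

Section complex_parts.
Variable R : realType.
Implicit Types x y z : R[i].

Lemma ReD x y : complex.Re (x + y) = complex.Re x + complex.Re y.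
Proof. by case: x y => [a b] [c d]. Qed.

Lemma ImD x y : complex.Im (x + y) = complex.Im x + complex.Im y.
Proof. by case: x y => [a b] [c d]. Qed.

Lemma ReM x y : complex.Re (x * y) =
  complex.Re x * complex.Re y - complex.Im x * complex.Im y.
Proof. by case: x y => [a b] [c d]. Qed.

Lemma ImM x y : complex.Im (x * y) =
  complex.Re x * complex.Im y + complex.Im x * complex.Re y.
Proof. by case: x y => [a b] [c d]. Qed.

Lemma Re_conjc x : complex.Re (conjc x) = complex.Re x.
Proof. by case: x. Qed.

Lemma Im_conjc x : complex.Im (conjc x) = - complex.Im x.
Proof. by case: x. Qed.

Lemma conjcM x y : conjc (x * y) = conjc x * conjc y.
Proof. exact: rmorphM. Qed.

Lemma complex_eqP x y :
  complex.Re x = complex.Re y -> complex.Im x = complex.Im y -> x = y.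
Proof. by case: x y => [a b] [c d] /= -> ->. Qed.

Lemma sqmod_ge0 z : 0 <= sqmod z.
Proof. by rewrite addr_ge0// sqr_ge0. Qed.

Lemma sqmodM x y : sqmod (x * y) = sqmod x * sqmod y.
Proof. rewrite /sqmod ReM ImM; ring. Qed.

Lemma sqmod_conjc x : sqmod (conjc x) = sqmod x.
Proof. by rewrite /sqmod Re_conjc Im_conjc sqrrN. Qed.

(** The parallelogram law without the term [sqmod (x - y)]. *)
Lemma sqmodD x y : sqmod (x + y) <= 2 * sqmod x + 2 * sqmod y.
Proof.
rewrite /sqmod ReD ImD.
have := sqr_ge0 (complex.Re x - complex.Re y).
have := sqr_ge0 (complex.Im x - complex.Im y).
by rewrite !sqrrB !sqrrD; lra.
Qed.

Lemma sqmod_eq0 z : (sqmod z == 0) = (z == 0).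
Proof.
case: z => a b; rewrite /sqmod /= paddr_eq0 ?sqr_ge0// !sqrf_eq0.
by rewrite eq_complex.
Qed.

Lemma sqmod_normc z : `|z| = (Num.sqrt (sqmod z))%:C%C.
Proof. by rewrite normc_def. Qed.

Lemma sqmod_expi (a : R) : sqmod (expi a) = 1.
Proof. by rewrite /sqmod /= cos2Dsin2. Qed.

Lemma expiD (a b : R) : expi (a + b) = expi a * expi b.
Proof. by apply: complex_eqP; rewrite ?ReM ?ImM /= ?cosD ?sinD // addrC. Qed.

Lemma expiN (a : R) : expi (- a) = conjc (expi a).
Proof. by rewrite /expi cosN sinN. Qed.

Lemma expi0 : expi (0 : R) = 1.
Proof. by rewrite /expi cos0 sin0. Qed.

Lemma expi_conj (a : R) : expi a * conjc (expi a) = 1.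
Proof. by rewrite -expiN -expiD subrr expi0. Qed.

Lemma expi_2pi_int (k : int) : expi (2 * pi * k%:~R : R) = 1.
Proof.
have h n : expi (2 * pi * n%:R : R) = 1.
  elim: n => [|n IH]; first by rewrite mulr0 expi0.
  rewrite -[n.+1%:R]natr1 mulrDr mulr1 expiD IH mul1r.
  by rewrite /expi mulr_natl cos2pi sin2pi.
case: k => n; first exact: h.
by rewrite NegzE mulrNz mulrN expiN h /conjc /= oppr0.
Qed.

End complex_parts.

(** * Closure properties of measurable and of square-integrable functions *)

Section measurability.
Context (R : realType) (n : nat).
Implicit Types (f h : 'cV[R]_n -> R[i]) (v : 'cV[R]_n).

Definition cmeas f := Rn_measurable_fun (fun t => complex.Re (f t)) /\
  Rn_measurable_fun (fun t => complex.Im (f t)).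

Lemma cmeas_cst (c : R[i]) : cmeas (fun=> c).
Proof. by split; exact: measurable_cst. Qed.

Lemma cmeasD f h : cmeas f -> cmeas h -> cmeas (fun t => f t + h t).
Proof.
move=> [rf jf] [rh jh]; split; rewrite /Rn_measurable_fun.
  by under eq_fun do rewrite ReD; exact: measurable_funD.
by under eq_fun do rewrite ImD; exact: measurable_funD.
Qed.

Lemma cmeasM f h : cmeas f -> cmeas h -> cmeas (fun t => f t * h t).
Proof.
move=> [rf jf] [rh jh]; split; rewrite /Rn_measurable_fun.
  by under eq_fun do rewrite ReM; apply: measurable_funB; exact: measurable_funM.
by under eq_fun do rewrite ImM; apply: measurable_funD; exact: measurable_funM.
Qed.

Lemma cmeas_conjc f : cmeas f -> cmeas (fun t => conjc (f t)).
Proof.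
move=> [rf jf]; split; rewrite /Rn_measurable_fun.
  by under eq_fun do rewrite Re_conjc; exact: rf.
by under eq_fun do rewrite Im_conjc; exact: measurableT_comp jf.
Qed.

Lemma cmeas_reflect v f : cmeas f -> cmeas (fun t => f (v - t)).
Proof.
by move=> [rf jf]; split; [exact: (measurable_reflect v rf)|exact: (measurable_reflect v jf)].
Qed.

Lemma measurable_dotR v : Rn_measurable_fun (dotR v).
Proof.
rewrite /Rn_measurable_fun /dotR; apply: measurable_sum => i.
apply: measurable_funM => //.
have := @measurable_tnth _ R n i.
by apply: eq_measurable_fun => t _; rewrite mxE.
Qed.

Lemma cmeas_expi v (a : R) : cmeas (fun t => expi (a * dotR v t)).
Proof.
have m : measurable_fun setT (fun t : n.-tuple R => a * dotR v (cV_of_tuple t)).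
  by apply: measurable_funM => //; exact: measurable_dotR.
split.
  exact: (measurableT_comp (continuous_measurable_fun (@continuous_cos R)) m).
exact: (measurableT_comp (continuous_measurable_fun (@continuous_sin R)) m).
Qed.

Lemma measurable_sqmod f : cmeas f -> Rn_measurable_fun (fun t => sqmod (f t)).
Proof.
move=> [rf jf]; rewrite /Rn_measurable_fun /sqmod.
by apply: measurable_funD; exact: measurable_funX.
Qed.

Lemma L2P f : L2 f <-> cmeas f /\
  (\int[Rn_measure R n]_t (sqmod (f (cV_of_tuple t)))%:E < +oo)%E.
Proof.
have h : cmeas f -> Rn_int (fun t => (sqmod (f t))%:E) =
    (\int[Rn_measure R n]_t (sqmod (f (cV_of_tuple t)))%:E)%E.
  move=> mf; apply: Rn_int_measure => [|t]; last by rewrite lee_fin sqmod_ge0.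
  by apply/measurable_EFinP; exact: measurable_sqmod.
split=> [[rf jf]|[[rf jf]]]; first by rewrite h.
by move=> fo; split=> //; rewrite h.
Qed.

Lemma L2_cmeas f : L2 f -> cmeas f. Proof. by case/L2P. Qed.

Lemma le_L2 f h (c : R) : 0 <= c -> cmeas f ->
  (forall t, sqmod (f t) <= c * sqmod (h t)) -> L2 h -> L2 f.
Proof.
move=> c0 mf fh /L2P[mh ho]; apply/L2P; split=> //.
apply: (@le_lt_trans _ _ (\int[Rn_measure R n]_t (c%:E * (sqmod (h (cV_of_tuple t)))%:E))%E).
  apply: ge0_le_integral => //.
  - by move=> t _; rewrite lee_fin sqmod_ge0.
  - by apply/measurable_EFinP; exact: measurable_sqmod.
  - by apply/measurable_EFinP/measurable_funM => //; exact: measurable_sqmod.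
  - by move=> t _; rewrite -EFinM lee_fin.
rewrite ge0_integralZl_EFin//.
- by rewrite lte_mul_pinfty.
- by move=> t _; rewrite lee_fin sqmod_ge0.
- by apply/measurable_EFinP; exact: measurable_sqmod.
Qed.

Lemma L2D f h : L2 f -> L2 h -> L2 (fun t => f t + h t).
Proof.
move=> /L2P[mf fo] /L2P[mh ho]; apply/L2P; split; first exact: cmeasD.
have m2 k : cmeas k -> measurable_fun setT
    (fun t : n.-tuple R => (2%:E * (sqmod (k (cV_of_tuple t)))%:E)%E).
  by move=> mk; apply/measurable_EFinP/measurable_funM => //; exact: measurable_sqmod.
have f2 k : cmeas k ->
    (\int[Rn_measure R n]_t (sqmod (k (cV_of_tuple t)))%:E < +oo)%E ->
    (\int[Rn_measure R n]_t (2%:E * (sqmod (k (cV_of_tuple t)))%:E) < +oo)%E.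
  move=> mk ko; rewrite ge0_integralZl_EFin//.
  - by rewrite lte_mul_pinfty.
  - by move=> t _; rewrite lee_fin sqmod_ge0.
  - by apply/measurable_EFinP; exact: measurable_sqmod.
apply: (@le_lt_trans _ _ (\int[Rn_measure R n]_t (2%:E * (sqmod (f (cV_of_tuple t)))%:E
    + 2%:E * (sqmod (h (cV_of_tuple t)))%:E))%E).
  apply: ge0_le_integral => //.
  - by move=> t _; rewrite lee_fin sqmod_ge0.
  - by apply/measurable_EFinP; exact: (measurable_sqmod (cmeasD mf mh)).
  - by apply: emeasurable_funD; exact: m2.
  - by move=> t _; rewrite -!EFinM -EFinD lee_fin sqmodD.
rewrite ge0_integralD//; [|by move=> t _; rewrite -EFinM lee_fin mulr_ge0// sqmod_ge0
  |exact: m2|by move=> t _; rewrite -EFinM lee_fin mulr_ge0// sqmod_ge0|exact: m2].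
by rewrite lte_add_pinfty// f2.
Qed.

Lemma L2M_bounded (u : 'cV[R]_n -> R[i]) (c : R) f :
  0 <= c -> cmeas u -> (forall t, sqmod (u t) <= c) -> L2 f -> L2 (fun t => u t * f t).
Proof.
move=> c0 mu uc L2f; apply: (le_L2 c0) (L2f).
  exact: (cmeasM mu (L2_cmeas L2f)).
by move=> t; rewrite sqmodM ler_wpM2r ?sqmod_ge0.
Qed.

Lemma L2Z (c : R[i]) f : L2 f -> L2 (fun t => c * f t).
Proof. by apply: (@L2M_bounded _ (sqmod c)); rewrite ?sqmod_ge0//; exact: cmeas_cst. Qed.

Lemma L2_sum m (b : 'I_m -> 'cV[R]_n -> R[i]) (c : 'I_m -> R[i]) :
  (forall i, L2 (b i)) -> L2 (fun t => \sum_i c i * b i t).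
Proof.
move=> L2b; elim: m b c L2b => [|m IH] b c L2b.
  under eq_fun do rewrite big_ord0.
  apply/L2P; split; first exact: cmeas_cst.
  rewrite (_ : (fun _ => _) = cst 0%E) ?integral0//.
  by apply/funext => t; rewrite /sqmod /= expr0n addr0.
under eq_fun do rewrite big_ord_recl.
by apply: L2D; [exact: L2Z|exact: (IH (fun i => b (lift ord0 i)) (fun i => c (lift ord0 i)))].
Qed.

Lemma L2_reflect v f : L2 f -> L2 (fun t => f (v - t)).
Proof.
move=> [rf jf fo]; have mf : cmeas f by [].
have [rf' jf'] := cmeas_reflect v mf; split=> //.
rewrite (Rn_int_reflect v (F := fun t => (sqmod (f t))%:E))//.
  by apply/measurable_EFinP; exact: measurable_sqmod.
by move=> t; rewrite lee_fin sqmod_ge0.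
Qed.

End measurability.

(** * Equality almost everywhere, reflections and translations *)

Section almost_everywhere.
Context (R : realType) (n : nat).
Implicit Types (f h : 'cV[R]_n -> R[i]) (v : 'cV[R]_n).

Lemma Rn_leb_measure (N : set 'cV[R]_n) : Rn_measurable N ->
  Rn_leb N = Rn_measure R n [set t | N (cV_of_tuple t)].
Proof.
move=> mN; rewrite /Rn_leb Rn_int_measure.
- by have := integral_indic (Rn_measure R n) measurableT mN; rewrite setIT.
- by apply/measurable_EFinP; exact: (measurable_indic mN).
- by move=> t; rewrite lee_fin.
Qed.

(** Gives access to the filter of almost everywhere statements; the null sets are carried from
    column vectors to tuples and back. *)
Lemma ae_eqP f h : Defs.ae_eq f h <->
  {ae Rn_measure R n, forall t, f (cV_of_tuple t) = h (cV_of_tuple t)}.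
Proof.
split=> [[N [mN N0 fh]]|[A [mA A0 fh]]].
  exists [set t | N (cV_of_tuple t)]; split=> //; first by rewrite -Rn_leb_measure.
  by move=> t /= nfh; apply: contrapT => Nt; apply: nfh; exact: fh.
have e : [set t | [set v | A (tuple_of_cV v)] (cV_of_tuple t)] = A.
  by apply/seteqP; split=> t /=; rewrite cV_of_tupleK.
have mN : Rn_measurable [set v | A (tuple_of_cV v)] by rewrite /Rn_measurable e.
exists [set v | A (tuple_of_cV v)]; split=> //; first by rewrite Rn_leb_measure// e.
move=> v; apply: contra_notP => fhv; apply: fh => /=.
by rewrite tuple_of_cVK.
Qed.

Lemma ae_eq_reflect v f h : Defs.ae_eq f h ->
  Defs.ae_eq (fun t => f (v - t)) (fun t => h (v - t)).
Proof.
move=> [N [mN N0 fh]]; exists [set t | N (v - t)]; split.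
- have := measurable_sub_tuple v measurableT mN; rewrite setTI /Rn_measurable.
  by congr measurable; apply/seteqP; split=> t /=; rewrite tuple_of_cVK.
- rewrite -N0 /Rn_leb -[RHS](Rn_int_reflect v)//.
  by apply/measurable_EFinP; exact: (measurable_indic mN).
- by move=> t; exact: fh.
Qed.

Lemma ae_eq0P f : cmeas f -> Defs.ae_eq f (fun=> 0) <->
  (\int[Rn_measure R n]_t (sqmod (f (cV_of_tuple t)))%:E = 0)%E.
Proof.
move=> mf; have m2 : measurable_fun setT (fun t : n.-tuple R => (sqmod (f (cV_of_tuple t)))%:E).
  by apply/measurable_EFinP; exact: measurable_sqmod.
have -> : (\int[Rn_measure R n]_t (sqmod (f (cV_of_tuple t)))%:E =
  \int[Rn_measure R n]_t `|(sqmod (f (cV_of_tuple t)))%:E|)%E.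
  by apply: eq_integral => t _; rewrite gee0_abs// lee_fin sqmod_ge0.
rewrite ae_eq_integral_abs// ae_eqP; split; apply: filterS => t /=.
  by move=> -> _; rewrite /sqmod /= expr0n addr0.
by move=> /(_ I)[] /eqP; rewrite sqmod_eq0 => /eqP.
Qed.

Lemma integral_reflect_Rn v (G : 'cV[R]_n -> \bar R) :
  measurable_fun setT (fun t : n.-tuple R => G (cV_of_tuple t)) ->
  (forall t, 0 <= G t)%E ->
  (\int[Rn_measure R n]_t G (v - cV_of_tuple t)%R = \int[Rn_measure R n]_t G (cV_of_tuple t))%E.
Proof.
move=> mG G0; rewrite -[RHS]Rn_int_measure// -(Rn_int_reflect v mG G0).
by rewrite Rn_int_measure//; exact: measurable_reflect.
Qed.

(* Reduces translations to reflections. *)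
Lemma sub_reflect v (t : 'cV[R]_n) : t - v = 0 - (v - t).
Proof. by rewrite sub0r opprB. Qed.

Lemma measurable_shift d (U : measurableType d) v (F : 'cV[R]_n -> U) :
  measurable_fun setT (fun t : n.-tuple R => F (cV_of_tuple t)) ->
  measurable_fun setT (fun t : n.-tuple R => F (cV_of_tuple t - v)).
Proof.
move=> mF; have := @measurable_reflect _ _ R n v (fun t => F (0 - t))
  (@measurable_reflect _ _ R n 0 F mF).
by apply: eq_measurable_fun => t _ /=; rewrite -sub_reflect.
Qed.

Lemma integral_shift v (G : 'cV[R]_n -> \bar R) :
  measurable_fun setT (fun t : n.-tuple R => G (cV_of_tuple t)) ->
  (forall t, 0 <= G t)%E ->
  (\int[Rn_measure R n]_t G (cV_of_tuple t - v)%R = \int[Rn_measure R n]_t G (cV_of_tuple t))%E.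
Proof.
move=> mG G0; rewrite -(integral_reflect_Rn 0 mG G0).
rewrite -(@integral_reflect_Rn v (fun t => G (0 - t)))//;
  last exact: (@measurable_reflect _ _ R n 0 G mG).
by apply: eq_integral => t _; rewrite -sub_reflect.
Qed.

Lemma cmeas_shift v f : cmeas f -> cmeas (fun t => f (t - v)).
Proof.
move=> mf; have := cmeas_reflect v (cmeas_reflect 0 mf).
by under eq_fun do rewrite -sub_reflect.
Qed.

Lemma L2_shift v f : L2 f -> L2 (fun t => f (t - v)).
Proof.
move=> mf; have := L2_reflect v (L2_reflect 0 mf).
by under eq_fun do rewrite -sub_reflect.
Qed.

Lemma ae_eq_shift v f h : Defs.ae_eq f h ->
  Defs.ae_eq (fun t => f (t - v)) (fun t => h (t - v)).
Proof.
move=> fh; have := ae_eq_reflect v (ae_eq_reflect 0 fh).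
under eq_fun do rewrite -sub_reflect.
by under [X in Defs.ae_eq _ X]eq_fun do rewrite -sub_reflect.
Qed.

End almost_everywhere.

(** * Complex integrals *)

Section dot_product.
Context (R : realType) (n : nat).
Implicit Types u v w : 'cV[R]_n.

Lemma dotRC u v : dotR u v = dotR v u.
Proof. by apply: eq_bigr => i _; rewrite mulrC. Qed.

Lemma dotRDr u v w : dotR u (v + w) = dotR u v + dotR u w.
Proof. by rewrite -big_split; apply: eq_bigr => i _; rewrite mxE mulrDr. Qed.

Lemma dotRNr u v : dotR u (- v) = - dotR u v.
Proof. by rewrite -sumrN; apply: eq_bigr => i _; rewrite mxE mulrN. Qed.

Lemma dotRBr u v w : dotR u (v - w) = dotR u v - dotR u w.
Proof. by rewrite dotRDr dotRNr. Qed.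

Lemma dotRZr (c : R) u v : dotR u (c *: v) = c * dotR u v.
Proof. by rewrite mulr_sumr; apply: eq_bigr => i _; rewrite mxE mulrCA. Qed.

Lemma dotRZl (c : R) u v : dotR (c *: u) v = c * dotR u v.
Proof. by rewrite dotRC dotRZr dotRC. Qed.

End dot_product.

Section complex_integral.
Context (R : realType) (n : nat).
Implicit Types (f h F G : 'cV[R]_n -> R[i]).

Definition cintegrable F :=
  (Rn_measure R n).-integrable setT (fun t => (complex.Re (F (cV_of_tuple t)))%:E) /\
  (Rn_measure R n).-integrable setT (fun t => (complex.Im (F (cV_of_tuple t)))%:E).

Lemma cintegrable_cmeas F : cintegrable F -> cmeas F.
Proof.
by move=> [/integrableP[rF _] /integrableP[jF _]]; split; exact/measurable_EFinP.
Qed.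

(** Both parts of x y are bounded by |x|^2 + |y|^2, which is integrable. *)
Lemma cintegrableM f h : L2 f -> L2 h -> cintegrable (fun t => f t * h t).
Proof.
move=> L2f L2h; have [rm im] := cmeasM (L2_cmeas L2f) (L2_cmeas L2h).
have iS k : L2 k -> (Rn_measure R n).-integrable setT
    (fun t => (sqmod (k (cV_of_tuple t)))%:E).
  move=> /L2P[mk ko]; apply/integrableP; split.
    by apply/measurable_EFinP; exact: measurable_sqmod.
  by under eq_integral do rewrite gee0_abs ?lee_fin ?sqmod_ge0//.
have iD := integrableD measurableT (iS _ L2f) (iS _ L2h).
have nD x y : `|sqmod x + sqmod y| = sqmod x + sqmod y :> R.
  by rewrite ger0_norm// addr_ge0 ?sqmod_ge0.
have bound (x y : R[i]) : `|complex.Re (x * y)| <= sqmod x + sqmod y /\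
    `|complex.Im (x * y)| <= sqmod x + sqmod y.
  case: x y => [a b] [c d]; rewrite !ler_norml /sqmod /=.
  (* With these squares expanded, the four bounds are linear in the monomials. *)
  have := (sqr_ge0 (a - c), sqr_ge0 (b - d), sqr_ge0 (a + c), sqr_ge0 (b + d)).
  have := (sqr_ge0 (a - d), sqr_ge0 (b - c), sqr_ge0 (a + d), sqr_ge0 (b + c)).
  rewrite !sqrrB !sqrrD => -[[[h1 h2] h3] h4] [[[h5 h6] h7] h8].
  by split; lra.
split; apply: le_integrable iD => //; try exact/measurable_EFinP;
  by move=> t _; rewrite /= lee_fin nD; apply bound.
Qed.

Lemma Rn_cint_lin F G (c : R[i]) : cintegrable F -> cintegrable G ->
  Rn_cint (fun t => F t + c * G t) = Rn_cint F + c * Rn_cint G.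
Proof.
case: c => a b [rF jF] [rG jG].
have iZ (r : R) k : (Rn_measure R n).-integrable setT (fun t => (k t)%:E) ->
    (Rn_measure R n).-integrable setT (fun t => (r * k t)%:E).
  exact: integrableZl.
have iD k1 k2 : (Rn_measure R n).-integrable setT (fun t => (k1 t)%:E) ->
    (Rn_measure R n).-integrable setT (fun t => (k2 t)%:E) ->
    (Rn_measure R n).-integrable setT (fun t => (k1 t + k2 t)%:E).
  exact: integrableD.
have iB k1 k2 : (Rn_measure R n).-integrable setT (fun t => (k1 t)%:E) ->
    (Rn_measure R n).-integrable setT (fun t => (k2 t)%:E) ->
    (Rn_measure R n).-integrable setT (fun t => (k1 t - k2 t)%:E).
  exact: integrableB.
apply: complex_eqP; rewrite ?ReD ?ImD ?ReM ?ImM /=.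
  under [X in Rn_Rint X]eq_fun do rewrite ReD ReM /=.
  rewrite !Rn_Rint_measure//; last by apply (iD) => //; apply (iB); exact: iZ.
  by rewrite RintegralD// ?RintegralB// ?RintegralZl//; try apply (iB); exact: iZ.
under [X in Rn_Rint X]eq_fun do rewrite ImD ImM /=.
rewrite !Rn_Rint_measure//; last by apply (iD) => //; apply (iD); exact: iZ.
by rewrite !RintegralD// ?RintegralZl//; try apply (iD); exact: iZ.
Qed.


Lemma Rn_cintZ F (c : R[i]) : cintegrable F ->
  Rn_cint (fun t => c * F t) = c * Rn_cint F.
Proof.
(* Write c F as F + (c - 1) F. *)
move=> iF; have := Rn_cint_lin (c - 1) iF iF.
have -> : (fun t => F t + (c - 1) * F t) = (fun t => c * F t).
  by apply/funext => t; ring.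
by move=> ->; ring.
Qed.

Lemma cintegrable_conjc F : cintegrable F -> cintegrable (fun t => conjc (F t)).
Proof.
move=> [rF jF]; split.
  by under eq_fun do rewrite Re_conjc.
under eq_fun do rewrite Im_conjc -mulN1r.
exact: (integrableZl measurableT (-1) jF).
Qed.

Lemma Rn_cint_conjc F : cintegrable F -> Rn_cint (fun t => conjc (F t)) = conjc (Rn_cint F).
Proof.
move=> [rF jF]; apply: complex_eqP; rewrite ?Re_conjc ?Im_conjc /=.
  by congr Rn_Rint; apply/funext => t; rewrite Re_conjc.
under [X in Rn_Rint X]eq_fun do rewrite Im_conjc -mulN1r.
rewrite !Rn_Rint_measure//; last exact: (integrableZl measurableT (-1) jF).
by rewrite RintegralZl// mulN1r.
Qed.

Lemma Rn_cint_reflect v F : cmeas F -> Rn_cint (fun t => F (v - t)) = Rn_cint F.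
Proof.
move=> [rF jF]; rewrite /Rn_cint.
by rewrite (Rn_Rint_reflect v rF) (Rn_Rint_reflect v jF).
Qed.

Lemma Rn_cint_ae0 F : cintegrable F -> Defs.ae_eq F (fun=> 0) -> Rn_cint F = 0.
Proof.
move=> [rF jF] /ae_eqP F0; apply: complex_eqP => /=; rewrite Rn_Rint_measure//.
  rewrite /Rintegral (@ae_eq_integral _ _ _ (Rn_measure R n) setT (cst 0%E))//.
  - by rewrite integral0.
  - by case/integrableP: rF.
  - by apply: filterS F0 => t /= -> _.
rewrite /Rintegral (@ae_eq_integral _ _ _ (Rn_measure R n) setT (cst 0%E))//.
- by rewrite integral0.
- by case/integrableP: jF.
- by apply: filterS F0 => t /= -> _.
Qed.

End complex_integral.

(** * Time-frequency shifts and the short-time Fourier transform *)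

Section stft.
Context (R : realType) (d : nat).
Implicit Types (f g h : 'cV[R]_d -> R[i]) (a b v : 'cV[R]_d).

(** The operator pi(w) for w = (a, b). Its symmetric phase is chosen so that powers of pi(w) are
    again of this form. *)
Definition tfs a b f : 'cV[R]_d -> R[i] := fun t =>
  expi (- (pi * dotR a b)) * expi (2 * pi * dotR b t) * f (t - a).

(** The hypothesis says that the symplectic form of (a, b) and (c, e) vanishes, and then composing
    creates no extra phase. It holds for multiples of one vector. *)
Lemma tfs_comp a b c e f : dotR a e = dotR b c ->
  tfs a b (tfs c e f) = tfs (a + c) (b + e) f.
Proof.
move=> abce; apply/funext => t; rewrite /tfs !mulrA -!expiD.
have -> : t - (a + c) = t - a - c by rewrite opprD addrA.
congr (expi _ * _).
have -> : dotR (a + c) (b + e) = dotR a b + dotR a e + dotR b c + dotR c e.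
  by rewrite dotRC !dotRDr !(dotRC (b + e)) !dotRDr (dotRC c b); ring.
have -> : dotR (b + e) t = dotR b t + dotR e t by rewrite dotRC dotRDr !(dotRC t).
by rewrite dotRBr (dotRC e a) abce; ring.
Qed.

Lemma iter_tfs a b f k :
  iter k (tfs a b) f = tfs (k%:R *: a) (k%:R *: b) f.
Proof.
elim: k => [|k IH].
  apply/funext => t; rewrite /tfs !scale0r subr0 dotRC (dotRC 0 t).
  by rewrite -(scale0r t) !dotRZr !(mul0r, mulr0) oppr0 expi0 !mul1r.
rewrite iterS IH tfs_comp; last by rewrite !dotRZr (dotRC b).
by congr tfs; rewrite -natr1 scalerDl scale1r addrC.
Qed.

Lemma L2_tfs a b f : L2 f -> L2 (tfs a b f).
Proof.
move=> L2f; apply: (@L2M_bounded _ _ _ 1) => //; last exact: L2_shift.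
  by apply: cmeasM; [exact: cmeas_cst|exact: cmeas_expi].
by move=> t; rewrite sqmodM !sqmod_expi mulr1.
Qed.

Lemma L2_stft_kernel g (z : 'cV[R]_(d + d)) : L2 g ->
  L2 (fun t => conjc (g (t - usubmx z)) * expi (- (2 * pi * dotR (dsubmx z) t))).
Proof.
move=> L2g; under eq_fun do rewrite mulrC -mulNr.
apply: (@L2M_bounded _ _ _ 1) => //; first exact: cmeas_expi.
  by move=> t; rewrite sqmod_expi.
apply: (@le_L2 _ _ _ (fun t => g (t - usubmx z)) 1) => //; last exact: L2_shift.
  by apply: cmeas_conjc; apply: cmeas_shift; exact: L2_cmeas.
by move=> t; rewrite sqmod_conjc mul1r.
Qed.

Lemma cintegrable_stft g f (z : 'cV[R]_(d + d)) : L2 g -> L2 f ->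
  cintegrable (fun t => f t * conjc (g (t - usubmx z)) *
    expi (- (2 * pi * dotR (dsubmx z) t))).
Proof.
move=> L2g L2f; under eq_fun do rewrite -mulrA.
by apply: cintegrableM => //; exact: L2_stft_kernel.
Qed.

Lemma stft_lin g f h (c : R[i]) z : L2 g -> L2 f -> L2 h ->
  stft g (fun t => f t + c * h t) z = stft g f z + c * stft g h z.
Proof.
move=> L2g L2f L2h; rewrite /stft -Rn_cint_lin; [|exact: cintegrable_stft..].
by congr Rn_cint; apply/funext => t; ring.
Qed.

Lemma stft_window_ae0 g f z : L2 g -> L2 f -> Defs.ae_eq g (fun=> 0) ->
  stft g f z = 0.
Proof.
move=> L2g L2f g0; apply: Rn_cint_ae0; first exact: cintegrable_stft.
have [N [mN N0 gN]] := ae_eq_shift (usubmx z) g0.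
exists N; split=> // t Nt; rewrite gN//.
by rewrite /conjc /= oppr0 mulr0 mul0r.
Qed.

(* The substitution t -> x + a - t exchanges the two factors
   g(a - t) and g(t - x) of the integrand, up to conjugation and a phase. *)
Lemma stft_tfs_opp g a b (z : 'cV[R]_(d + d)) (k : int) : L2 g ->
  dotR b (usubmx z) - dotR a (dsubmx z) = k%:~R ->
  stft g (tfs a b (fun t => g (- t))) z =
  expi (- (2 * pi * dotR (dsubmx z) (usubmx z))) *
  conjc (stft g (tfs a b (fun t => g (- t))) z).
Proof.
move=> L2g hk; set f := tfs a b _.
have L2f : L2 f.
  apply: L2_tfs; have := L2_reflect 0 L2g.
  by under eq_fun do rewrite sub0r.
have iF := cintegrable_stft z L2g L2f.
have stftE : stft g f z = Rn_cint (fun t => f t * conjc (g (t - usubmx z)) *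
  expi (- (2 * pi * dotR (dsubmx z) t))) by [].
rewrite stftE; set x := usubmx z in hk iF *; set w := dsubmx z in hk iF *.
rewrite -[LHS](Rn_cint_reflect (x + a) (cintegrable_cmeas iF)) -Rn_cint_conjc//.
rewrite -Rn_cintZ; last exact: cintegrable_conjc.
congr Rn_cint; apply/funext => t.
rewrite /f /tfs !conjcM !conjcK -!expiN !opprK.
have -> : - (x + a - t - a) = t - x by rewrite addrAC addrK opprB.
have -> : x + a - t - x = a - t by rewrite addrAC (addrC x) addrK.
have -> : - (t - a) = a - t by rewrite opprB.
(* The exponents of the two sides differ by 2 pi (b.x - a.omega) = 2 pi k; this is where integrality
   enters. *)
have phase : expi (- (pi * dotR a b)) * expi (2 * pi * dotR b (x + a - t)) *
    expi (- (2 * pi * dotR w (x + a - t))) =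
  expi (- (2 * pi * dotR w x)) * (expi (pi * dotR a b) *
    expi (- (2 * pi * dotR b t)) * expi (2 * pi * dotR w t)).
  rewrite -[RHS]mulr1 -(expi_2pi_int R k) -!expiD -hk; congr expi.
  by rewrite !dotRBr !dotRDr (dotRC b a) (dotRC a w); ring.
(* The seven exponentials become free variables tied only by [phase]. *)
move: phase; move: (expi _) (expi _) (expi _) (expi _) (expi _) (expi _) (expi _).
move=> e7 e6 e5 e4 e3 e2 e1 phase.
transitivity ((e1 * e2 * e3) * (g (t - x) * conjc (g (a - t)))); first by ring.
by rewrite phase; ring.
Qed.

End stft.

(** * Time-frequency shifts have no eigenvector *)

Section shift_invariance.
Context (R : realType) (d : nat).
Implicit Types (f : 'cV[R]_d -> R[i]) (a b : 'cV[R]_d).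

(** An explicit strictly increasing map with values between 0 and 1, the source of the weight in the
    next argument. *)
Definition gompertz (s : R) : R := expR (- expR (- s)).

Lemma gompertz_gt0 s : 0 < gompertz s. Proof. exact: expR_gt0. Qed.

Lemma gompertz_le1 s : gompertz s <= 1.
Proof. by rewrite /gompertz -(@expR0 R) ler_expR oppr_le0 expR_ge0. Qed.

Lemma gompertz_lt s s' : s < s' -> gompertz s < gompertz s'.
Proof. by move=> ss'; rewrite /gompertz ltr_expR ltrN2 ltr_expR ltrN2. Qed.

Lemma measurable_gompertz : measurable_fun setT gompertz.
Proof.
apply: measurableT_comp; first exact: measurable_expR.
by apply: measurableT_comp => //; apply: measurableT_comp.
Qed.

(* For a bounded positive weight w with w(t - a) < w(t), the invariance of F
   gives \int F (w - w(. - a)) = 0. *)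
Lemma shift_invariant_ae0 a (F : 'cV[R]_d -> R) : a != 0 ->
  Rn_measurable_fun F -> (forall t, 0 <= F t) ->
  (\int[Rn_measure R d]_t (F (cV_of_tuple t))%:E < +oo)%E ->
  {ae Rn_measure R d, forall t, F (cV_of_tuple t - a) = F (cV_of_tuple t)} ->
  {ae Rn_measure R d, forall t, F (cV_of_tuple t) = 0}.
Proof.
move=> a0 mF F0 Foo Fa.
have [i ai] : exists i, a i ord0 != 0.
  apply: contrapT => h; move/eqP: a0; apply; apply/colP => i; rewrite mxE.
  by apply: contrapT => /eqP ai; apply: h; exists i.
have [w [mw wlt w0 w1]] : exists w : 'cV[R]_d -> R, [/\ Rn_measurable_fun w,
    forall t, w (t - a) < w t, forall t, 0 < w t & forall t, w t <= 1].
  (* Under t -> t - a the quotient t_i / a_i drops by exactly 1, whatever the sign of a_i. *)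
  exists (fun t => gompertz (t i ord0 / a i ord0)); split=> [|t|t|t].
  - apply: measurableT_comp; first exact: measurable_gompertz.
    apply: measurable_funM => //; have := @measurable_tnth _ R d i.
    by apply: eq_measurable_fun => t _; rewrite mxE.
  - by apply: gompertz_lt; rewrite !mxE mulrBl divff// ltrBlDr ltrDl.
  - exact: gompertz_gt0.
  - exact: gompertz_le1.
have mwa : measurable_fun setT (fun t : d.-tuple R => w (cV_of_tuple t - a)).
  exact: measurable_shift.
have mFw : measurable_fun setT (fun t : d.-tuple R => F (cV_of_tuple t) * w (cV_of_tuple t)).
  exact: measurable_funM.
have mFwa : measurable_fun setT (fun t : d.-tuple R => F (cV_of_tuple t) * w (cV_of_tuple t - a)).
  exact: measurable_funM.
have [D DE] : exists D : 'cV[R]_d -> R, forall t, D t = F t * (w t - w (t - a)).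
  by exists (fun t => F t * (w t - w (t - a))).
have D0 t : 0 <= D t by rewrite DE mulr_ge0// subr_ge0 ltW.
have mD : measurable_fun setT (fun t : d.-tuple R => D (cV_of_tuple t)).
  by under eq_fun do rewrite DE; apply: measurable_funM => //; exact: measurable_funB.
have Fw0 t : 0 <= F t * w t by rewrite mulr_ge0// ltW.
have Fwa0 t : 0 <= F t * w (t - a) by rewrite mulr_ge0// ltW.
(* Translate the integral of F w by a, then replace F(t - a) by F(t). *)
have inv : (\int[Rn_measure R d]_t (F (cV_of_tuple t) * w (cV_of_tuple t))%:E =
            \int[Rn_measure R d]_t (F (cV_of_tuple t) * w (cV_of_tuple t - a))%:E)%E.
  have mEFw : measurable_fun setT (fun t : d.-tuple R =>
      (F (cV_of_tuple t) * w (cV_of_tuple t))%:E).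
    exact/measurable_EFinP.
  rewrite -(@integral_shift _ _ a (fun t => (F t * w t)%:E) mEFw)//.
  apply: ge0_ae_eq_integral => //.
  - apply/measurable_EFinP.
    exact: (@measurable_shift R d _ _ a (fun t => F t * w t) mFw).
  - exact/measurable_EFinP.
  - by move=> t _; rewrite lee_fin.
  - by move=> t _; rewrite lee_fin.
  - by apply: filterS Fa => t /= -> _.
have : (\int[Rn_measure R d]_t (F (cV_of_tuple t) * w (cV_of_tuple t))%:E =
    \int[Rn_measure R d]_t (F (cV_of_tuple t) * w (cV_of_tuple t - a))%:E +
    \int[Rn_measure R d]_t (D (cV_of_tuple t))%:E)%E.
  rewrite -ge0_integralD//.
  - by apply: eq_integral => t _; rewrite -EFinD DE; congr EFin; ring.
  - by move=> t _; rewrite lee_fin.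
  - exact/measurable_EFinP.
  - by move=> t _; rewrite lee_fin.
  - exact/measurable_EFinP.
rewrite -inv => IX.
(* Finiteness, from w <= 1, is what allows cancelling this integral in [IX]. *)
have Ifin : (\int[Rn_measure R d]_t (F (cV_of_tuple t) * w (cV_of_tuple t))%:E)%E \is a fin_num.
  rewrite ge0_fin_numE; last by apply: integral_ge0 => t _; rewrite lee_fin.
  apply: le_lt_trans Foo; apply: ge0_le_integral => //.
  - by move=> t _; rewrite lee_fin.
  - exact/measurable_EFinP.
  - exact/measurable_EFinP.
  - by move=> t _; rewrite lee_fin ler_piMr.
have ID0 : (\int[Rn_measure R d]_t (D (cV_of_tuple t))%:E = 0)%E.
  by rewrite -[LHS](addeK _ Ifin) [X in (X - _)%E]addeC -IX subee.
have mED : measurable_fun setT (fun t : d.-tuple R => (D (cV_of_tuple t))%:E).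
  exact/measurable_EFinP.
have absD : (\int[Rn_measure R d]_t `|(D (cV_of_tuple t))%:E| = 0)%E.
  rewrite -[RHS]ID0; apply: eq_integral => t _; rewrite gee0_abs// lee_fin.
  exact: D0.
have D_ae0 := (ae_eq_integral_abs (Rn_measure R d) measurableT mED).1 absD.
apply: filterS D_ae0 => t /= /(_ I)[] /eqP; rewrite DE mulf_eq0 subr_eq0 => /orP[/eqP//|].
by rewrite gt_eqF.
Qed.

Lemma sub_image_countable T U (g : T -> U) (A : set T) (B : set U) :
  countable A -> B `<=` g @` A -> countable B.
Proof.
move=> cA BA; apply: sub_countable cA.
exact: card_le_trans (subset_card_le BA) (card_image_le g A).
Qed.

(** The double angle formula gives sin(pi r) = 0, while the sine is positive strictly between 0 and
    pi. *)
Lemma expi_eq1 (r : R) : 0 <= r < 1 -> expi (2 * pi * r) = 1 -> r = 0.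
Proof.
move=> /andP[r0 r1] e1.
have c1 : cos (2 * pi * r) = 1 by case: e1.
have sr : sin (pi * r) = 0.
  have : cos ((pi * r) *+ 2) = 1 by rewrite -mulr_natl mulrA.
  rewrite cos_mulr2n cos2sin2 => c2.
  by apply/eqP; rewrite -sqrf_eq0; apply/eqP; lra.
apply/eqP; rewrite eq_le r0 andbT leNgt; apply/negP => r_gt0.
suff : 0 < sin (pi * r) by rewrite sr ltxx.
by apply: sin_gt0_pi; rewrite mulr_gt0 ?pi_gt0// gtr_pMr ?pi_gt0.
Qed.

(** The set is empty or a single coset of the integers, since the fractional part of a difference of
    two solutions is 0. *)
Lemma countable_expi (l : R[i]) : countable [set s : R | expi (2 * pi * s) = l].
Proof.
have [[s0 s0l]|none] := pselect (exists s0 : R, expi (2 * pi * s0) = l); last first.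
  by rewrite (_ : mkset _ = set0)//; apply/seteqP; split=> // s sl; apply: none; exists s.
apply: (@sub_image_countable int R (fun k => s0 + k%:~R) setT) => //.
move=> s /= sl; exists (Num.floor (s - s0)) => //.
have /andP[fl fu] := floor_itv (s - s0).
have : s - s0 - (Num.floor (s - s0))%:~R = 0.
  apply: expi_eq1.
    by rewrite subr_ge0 fl /= ltrBlDl -[_%:~R + 1]intrD1.
  rewrite !mulrBr !expiD !expiN expi_2pi_int sl -s0l expi_conj.
  by rewrite /conjc /= oppr0 mulr1.
by move=> h; lra.
Qed.

(** Countably many parallel hyperplanes form a null set. If the tail of b is nonzero, every slice is
    null by induction; otherwise the condition bears on the first coordinate alone and leaves it
    countably many values. *)
Lemma Rn_int_hyperplane n (b : 'cV[R]_n) (E : set R) : b != 0 -> countable E ->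
  Rn_int (fun t => (\1_E (dotR b t))%:E) = 0%E.
Proof.
elim: n b E => [|n IH] b E b0 cE.
  by move/eqP: b0; case; apply/colP => -[].
rewrite /=; set b1 := b ord0 ord0; set b' : 'cV[R]_n := \col_i b (lift ord0 i) ord0.
have dE x t : dotR b (cons_cV x t) = b1 * x + dotR b' t.
  rewrite /dotR big_ord_recl !mxE unlift_none; congr (_ + _).
  by apply: eq_bigr => i _; rewrite !mxE liftK.
have [b'0|b'0] := eqVneq b' 0; last first.
  apply: integral0_eq => x _; rewrite -[RHS](IH b' [set s | E (b1 * x + s)])//.
    by congr Rn_int; apply/funext => t; rewrite dE.
  apply: (@sub_image_countable _ _ (fun s => s - b1 * x) E) => // s /= Es.
  by exists (b1 * x + s) => //; rewrite addrAC subrr add0r.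
have b10 : b1 != 0.
  apply: contra b0 => /eqP b10; rewrite -(cons_cVK b) -/b1 -/b' b10 b'0.
  by apply/eqP/colP => i; rewrite !mxE; case: unliftP => [j|] _; rewrite ?mxE.
pose E' := [set x | E (b1 * x)].
have cE' : countable E'.
  apply: (@sub_image_countable _ _ (fun s => s / b1) E) => // s /= Es.
  by exists (b1 * s) => //; rewrite mulrAC divff// mul1r.
have mE' : measurable (E' : set (measurableTypeR R)).
  by apply: countable_measurable => // x; exact: measurable_set1.
(* Each slice is empty or everything. The second factor may be infinite; the convention that 0 times
   infinity is 0 absorbs it. *)
transitivity (\int[@lebesgue_measure R]_x ((\1_E' x)%:E * @Rn_int R n (cst 1)))%E.
  apply: eq_integral => x _.
  have -> : (fun t => (\1_E (dotR b (cons_cV x t)))%:E) = cst ((\1_E' x)%:E : \bar R).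
    by apply/funext => t; rewrite dE b'0 -(scale0r b') dotRZl mul0r addr0.
  rewrite indicE; case: (x \in E') => /=; first by rewrite mul1e.
  by rewrite mul0e Rn_int_measure//= integral0.
rewrite ge0_integralZr//.
- rewrite -[RHS](mul0e (@Rn_int R n (cst 1%E))); congr (_ * _)%E.
  by rewrite integral_indic// setIT; exact: countable_lebesgue_measure0.
- apply/measurable_EFinP; exact: measurable_indic.
- rewrite Rn_int_measure//; exact: integral_ge0.
Qed.

End shift_invariance.

Section eigenvector.
Context (R : realType) (d : nat).
Implicit Types (f : 'cV[R]_d -> R[i]) (a b : 'cV[R]_d).

Lemma sqmod_tfs a b f t : sqmod (tfs a b f t) = sqmod (f (t - a)).
Proof. by rewrite /tfs !sqmodM !sqmod_expi !mul1r. Qed.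

(** If a is nonzero, translating |f|^2 by a multiplies it by |l|^2: for |l| = 1 it is translation
    invariant, hence zero, and otherwise its finite integral must vanish. If a = 0, then f vanishes
    almost everywhere off the null set where e^{2 i pi b.t} = l. *)
Lemma tfs_eigen0 a b f (l : R[i]) : L2 f -> (a != 0) || (b != 0) ->
  Defs.ae_eq (tfs a b f) (fun t => l * f t) -> Defs.ae_eq f (fun=> 0).
Proof.
move=> L2f ab0 eig; have mf := L2_cmeas L2f.
have msf := measurable_sqmod mf.
have mEsf : measurable_fun setT (fun t : d.-tuple R => (sqmod (f (cV_of_tuple t)))%:E).
  exact/measurable_EFinP.
have sf0 t : 0 <= sqmod (f t) := sqmod_ge0 _.
have /L2P[_ fo] := L2f.
have [a0|a0] := eqVneq a 0; last first.
  have sfa : {ae Rn_measure R d, forall t,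
      sqmod (f (cV_of_tuple t - a)) = sqmod l * sqmod (f (cV_of_tuple t))}.
    move/ae_eqP: eig; apply: filterS => t /= e.
    by rewrite -sqmodM -e sqmod_tfs.
  have [l1|l1] := eqVneq (sqmod l) 1.
    apply/ae_eqP; have := @shift_invariant_ae0 R d a (fun t => sqmod (f t)) a0 msf sf0 fo.
    have e1 : {ae Rn_measure R d, forall t,
        sqmod (f (cV_of_tuple t - a)) = sqmod (f (cV_of_tuple t))}.
      by apply: filterS sfa => t ->; rewrite l1 mul1r.
    move=> /(_ e1); apply: filterS => t /eqP.
    by rewrite sqmod_eq0 => /eqP.
  apply/(ae_eq0P mf).
  have e : (\int[Rn_measure R d]_t (sqmod (f (cV_of_tuple t)))%:E =
      (sqmod l)%:E * \int[Rn_measure R d]_t (sqmod (f (cV_of_tuple t)))%:E)%E.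
    rewrite -[LHS](@integral_shift R d a (fun t => (sqmod (f t))%:E))//.
    have mfa : measurable_fun setT (fun t : d.-tuple R => (sqmod (f (cV_of_tuple t - a)))%:E).
      exact: (@measurable_shift R d _ _ a (fun t => (sqmod (f t))%:E) mEsf).
    rewrite -ge0_integralZl_EFin ?sqmod_ge0//; last by move=> t _; rewrite lee_fin.
    apply: ge0_ae_eq_integral => //.
    - by apply: measurable_funeM.
    - by move=> t _; rewrite lee_fin sqmod_ge0.
    - by move=> t _; rewrite -EFinM lee_fin mulr_ge0 ?sqmod_ge0.
    - by apply: filterS sfa => t /= -> _; rewrite EFinM.
  have I0 : (0 <= \int[Rn_measure R d]_t (sqmod (f (cV_of_tuple t)))%:E)%E.
    by apply: integral_ge0 => t _; rewrite lee_fin.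
  move: e fo I0; case: (integral _ _ _) => [r| |]// [e] _ _.
  congr EFin; apply/eqP; move/eqP: e; rewrite -subr_eq0 -{1}(mul1r r) -mulrBl.
  by rewrite mulf_eq0 subr_eq0 eq_sym (negbTE l1).
have b0 : b != 0 by rewrite a0 eqxx in ab0.
pose Z := [set s : R | expi (2 * pi * s) = l].
pose H := [set t : 'cV[R]_d | Z (dotR b t)].
have cZ : countable Z by exact: countable_expi.
have mH : Rn_measurable H.
  have mZ : measurable Z by apply: countable_measurable => // x; exact: measurable_set1.
  by have := measurable_dotR b measurableT mZ; rewrite setTI.
move: eig => [N [mN N0 fN]].
have mNP := Rn_leb_measure mN; have mHP := Rn_leb_measure mH.
have H0 : Rn_leb H = 0%E by exact: (Rn_int_hyperplane b0 cZ).
apply/ae_eqP; exists ([set t | N (cV_of_tuple t)] `|` [set t | H (cV_of_tuple t)]); split.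
- exact: measurableU.
- apply: null_set_setU; [exact: mN|exact: mH|exact: etrans (esym mNP) N0|].
  exact: etrans (esym mHP) H0.
- move=> t /= ft0; apply: contrapT => /not_orP[Nt Ht]; apply: ft0.
  move: (fN _ Nt); rewrite /tfs a0 subr0 dotRC -{1}(scale0r b) dotRZr mul0r mulr0 oppr0 expi0 mul1r.
  move/eqP; rewrite -subr_eq0 -mulrBl mulf_eq0 subr_eq0 => /orP[/eqP h|/eqP//].
  by case: Ht.
Qed.

End eigenvector.

(** * Linear independence of the iterates *)

Section independence.
Context (R : realType) (d : nat).
Implicit Types (f g : 'cV[R]_d -> R[i]) (a b : 'cV[R]_d).

Lemma tfs_sum a b n (c : 'I_n -> R[i]) (u : 'I_n -> 'cV[R]_d -> R[i]) :
  tfs a b (fun t => \sum_i c i * u i t) = (fun t => \sum_i c i * tfs a b (u i) t).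
Proof.
apply/funext => t; rewrite /tfs mulr_sumr; apply: eq_bigr => i _; ring.
Qed.

Lemma L2_iter_tfs a b f k : L2 f -> L2 (iter k (tfs a b) f).
Proof. by move=> L2f; elim: k => //= k; exact: L2_tfs. Qed.

(** The identity (q (X - r))(U) f = U q(U) f - r q(U) f, with [u i] in the role of U^i f. The bound
    on [size q] kills the coefficient of index n. *)
Lemma sum_coef_mulXsubC (K : comNzRingType) (q : {poly K}) (r : K) (u : nat -> K) n :
  (size q <= n)%N ->
  \sum_(i < n.+1) (q * ('X - r%:P))`_i * u i =
  \sum_(i < n) q`_i * u i.+1 - r * \sum_(i < n) q`_i * u i.
Proof.
move=> qn; under eq_bigr do rewrite mulrBr coefB coefMX coefMC mulrBl.
rewrite sumrB; congr (_ - _).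
  by rewrite big_ord_recl /= mul0r add0r; apply: eq_bigr => i _.
rewrite big_ord_recr /= (nth_default _ qn) !mul0r addr0 mulr_sumr.
by apply: eq_bigr => i _; ring.
Qed.

(* Splitting off a root r of p turns p(U) f = 0 into U h = r h with h = q(U) f,
   and a time-frequency shift has no eigenvector. *)
Lemma tfs_poly_ae0 a b f (p : {poly R[i]}) n : L2 f -> (a != 0) || (b != 0) ->
  p != 0 -> (size p <= n)%N ->
  Defs.ae_eq (fun t => \sum_(i < n) p`_i * iter i (tfs a b) f t) (fun=> 0) ->
  Defs.ae_eq f (fun=> 0).
Proof.
move=> L2f ab0; elim: n p => [|n IH] p p0 pn pf.
  by move: p0; rewrite -size_poly_eq0 -leqn0 pn.
have [p1|p1] := eqVneq (size p) 1%N.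
  move: pf => [N [mN N0 fN]]; exists N; split=> // t Nt; have := fN t Nt.
  rewrite big_ord_recl big1 ?addr0 => [/eqP|i _]; last first.
    by rewrite nth_default ?mul0r// p1.
  rewrite mulf_eq0 => /orP[/eqP pz|/eqP//].
  have := lead_coef_eq0 p; rewrite /lead_coef p1 /= in pz *.
  by rewrite pz eqxx (negbTE p0).
have /closed_rootP[r /factor_theorem[q pq]] := p1.
have q0 : q != 0 by apply: contra p0 => /eqP q0; rewrite pq q0 mul0r.
have qn : (size q <= n)%N.
  by rewrite -ltnS; move: pn; rewrite pq size_Mmonic ?monicXsubC// size_XsubC addn2.
apply: (IH q q0 qn).
apply: (@tfs_eigen0 _ _ a b _ r) => //.
  by apply: L2_sum => i; exact: L2_iter_tfs.
move: pf => [N [mN N0 fN]]; exists N; split=> // t Nt; have := fN t Nt.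
rewrite pq (sum_coef_mulXsubC _ (fun i => iter i (tfs a b) f t) qn) tfs_sum.
by move/eqP; rewrite subr_eq0 => /eqP.
Qed.

(** Linear independence in contrapositive form: a relation with one nonzero coefficient forces f =
    0. *)
Lemma iter_tfs_free a b f n (c : nat -> R[i]) k : L2 f -> (a != 0) || (b != 0) ->
  (k < n)%N -> c k != 0 ->
  Defs.ae_eq (fun t => \sum_(i < n) c i * iter i (tfs a b) f t) (fun=> 0) ->
  Defs.ae_eq f (fun=> 0).
Proof.
move=> L2f ab0 kn ck cf.
apply: (@tfs_poly_ae0 a b f (\poly_(i < n) c i) n) => //.
- by apply: contra ck => /eqP p0; have := coef_poly n c k; rewrite p0 coef0 kn => <-.
- move: cf => [N [mN N0 fN]]; exists N; split=> // t Nt; rewrite -[RHS](fN t Nt).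
  by apply: eq_bigr => i _; rewrite coef_poly ltn_ord.
Qed.

Lemma conjc0E : conjc (0 : R[i]) = 0.
Proof. by rewrite /conjc /= oppr0. Qed.

End independence.

(** * A nonzero square-integrable function *)

Section unit_cube.
Context (R : realType).

(** The indicator of the unit cube, as a product so that its iterated integral factors. It replaces
    the reflected window when the window is zero. *)
Definition cube n (t : 'cV[R]_n) : R := \prod_i \1_(`[0, 1] : set R) (t i ord0).

Lemma cube_cons n x (t : 'cV[R]_n) :
  cube (cons_cV x t) = \1_(`[0, 1] : set R) x * cube t.
Proof.
rewrite /cube big_ord_recl !mxE unlift_none; congr (_ * _).
by apply: eq_bigr => i _; rewrite !mxE liftK.
Qed.

Lemma measurable_cube n : Rn_measurable_fun (@cube n).
Proof.
apply: measurable_prod => i _.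
have m : measurable_fun setT (\1_(`[0, 1] : set R) : R -> R).
  by apply: measurable_indic; exact: measurable_itv.
have := measurableT_comp m (@measurable_tnth _ R n i).
by apply: eq_measurable_fun => t _ /=; rewrite mxE.
Qed.

Lemma cube_sqr n (t : 'cV[R]_n) : cube t ^+ 2 = cube t.
Proof.
rewrite /cube -prodrXl; apply: eq_bigr => i _.
by rewrite indicE; case: (_ \in _); rewrite ?expr1n ?expr0n.
Qed.

Lemma Rn_int_cube n : Rn_int (fun t : 'cV[R]_n => (cube t)%:E) = 1%E.
Proof.
elim: n => [|n IH] /=; first by rewrite /cube big_ord0.
transitivity (\int[@lebesgue_measure R]_x (\1_(`[0, 1] : set R) x)%:E)%E.
  apply: eq_integral => x _; under eq_fun do rewrite cube_cons.
  rewrite indicE; case: (_ \in _); first by under eq_fun do rewrite mul1r.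
  under eq_fun do rewrite mul0r.
  by rewrite Rn_int_measure//= integral0.
transitivity (@lebesgue_measure R `[0%R, 1%R]%classic).
  have m01 : measurable (`[0, 1]%classic : set R) by exact: measurable_itv.
  by have := integral_indic (@lebesgue_measure R) measurableT m01; rewrite setIT.
by rewrite lebesgue_measure_itv/= lte_fin ltr01 -EFinB subr0.
Qed.

Lemma sqmod_cube n (t : 'cV[R]_n) : sqmod (cube t)%:C%C = cube t.
Proof. by rewrite /sqmod /= expr0n addr0 cube_sqr. Qed.

Lemma L2_cube n : L2 (fun t : 'cV[R]_n => (cube t)%:C%C).
Proof.
split; [exact: measurable_cube|exact: measurable_cst|].
by under eq_fun do rewrite sqmod_cube; rewrite Rn_int_cube ltry.
Qed.

Lemma cube_not_ae0 n : ~ Defs.ae_eq (fun t : 'cV[R]_n => (cube t)%:C%C) (fun=> 0).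
Proof.
move/(ae_eq0P (L2_cmeas (@L2_cube n))).
under eq_integral do rewrite sqmod_cube.
rewrite -(@Rn_int_measure R n (fun t => (cube t)%:E)) ?Rn_int_cube.
- by case=> /eqP; rewrite oner_eq0.
- by apply/measurable_EFinP; exact: measurable_cube.
- by move=> t; rewrite lee_fin prodr_ge0// => i _; rewrite indicE.
Qed.

End unit_cube.

(** * The cone *)

Section symplectic_algebra.
Context (R : realType) (d : nat).

Lemma dotR_mulmx n (u v : 'cV[R]_n) : dotR u v = (u^T *m v) ord0 ord0.
Proof. by rewrite mxE; apply: eq_bigr => i _; rewrite mxE. Qed.

Lemma symplectic_form (u v : 'cV[R]_(d + d)) :
  (u^T *m Jmx R d *m v) ord0 ord0 =
  dotR (dsubmx u) (usubmx v) - dotR (usubmx u) (dsubmx v).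
Proof.
rewrite !dotR_mulmx -{1}(vsubmxK u) -{1}(vsubmxK v) tr_col_mx /Jmx mul_row_block.
by rewrite mul_row_col !mulmx0 mulmxN !mulmx1 add0r addr0 mulNmx !mxE addrC.
Qed.

(** S preserves the symplectic form, so the form can be evaluated on (k0, 0) and (x, lam), where x
    meets only the zero component. *)
Lemma symplectic_phase (S : 'M[R]_(d + d)) (k0 x lam : 'cV[R]_d) :
  symplectic S ->
  let u := S *m col_mx k0 0 in let v := S *m col_mx x lam in
  dotR (dsubmx u) (usubmx v) - dotR (usubmx u) (dsubmx v) = - dotR k0 lam.
Proof.
move=> [_ hS] /=; rewrite -symplectic_form trmx_mul -!mulmxA (mulmxA (Jmx R d)) (mulmxA S^T).
rewrite (mulmxA S^T) hS mulmxA symplectic_form !col_mxKu !col_mxKd.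
by rewrite -(scale0r k0) dotRZl mul0r sub0r.
Qed.

(** A basis vector of the dual lattice: the image of the first unit vector under the inverse
    transpose of A pairs with A k to the first coordinate of k. *)
Lemma exists_dual_vector (Lam : set 'cV[R]_d) : (0 < d)%N -> is_lattice Lam ->
  exists2 k0 : 'cV[R]_d, k0 != 0 &
    forall lam, Lam lam -> exists k : int, dotR k0 lam = k%:~R.
Proof.
move=> d0 [A [uA ->]]; pose i0 := Ordinal d0.
exists ((invmx A)^T *m delta_mx i0 ord0).
  apply/eqP => h; have : A^T *m ((invmx A)^T *m delta_mx i0 ord0) = 0 :> 'cV[R]_d.
    by rewrite h mulmx0.
  rewrite mulmxA -trmx_mul mulVmx// trmx1 mul1mx => /colP/(_ i0).
  by rewrite !mxE !eqxx => /eqP; rewrite oner_eq0.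
move=> _ [kk _ <-]; exists (kk i0 ord0).
rewrite dotR_mulmx trmx_mul trmxK -!mulmxA mulKmx// mxE (bigD1 i0)//= big1 => [|i ii0].
  by rewrite !mxE !eqxx mul1r addr0.
by rewrite !mxE (negbTE ii0) mul0r.
Qed.

End symplectic_algebra.

(** * Generators of the cone and their partners *)

Section main.
Context (R : realType) (d : nat).
Implicit Types (f g phi : 'cV[R]_d -> R[i]) (a b : 'cV[R]_d).

(** Treats zero and nonzero windows uniformly: afterwards only the conjugation symmetry of [stft] is
    used. For a zero window both sides of it are 0. *)
Lemma exists_generator g : L2 g -> exists phi, [/\ L2 phi,
  ~ Defs.ae_eq phi (fun=> 0) &
  forall a b (z : 'cV[R]_(d + d)) (k : int),
    dotR b (usubmx z) - dotR a (dsubmx z) = k%:~R ->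
    stft g (tfs a b phi) z = expi (- (2 * pi * dotR (dsubmx z) (usubmx z))) *
      conjc (stft g (tfs a b phi) z)].
Proof.
move=> L2g; have [g0|g0] := pselect (Defs.ae_eq g (fun=> 0)).
  exists (fun t => (cube t)%:C%C); split; [exact: L2_cube|exact: cube_not_ae0|].
  move=> a b z k _; rewrite stft_window_ae0//; last by apply: L2_tfs; exact: L2_cube.
  by rewrite conjc0E mulr0.
exists (fun t => g (- t)); split.
- by have := L2_reflect 0 L2g; under eq_fun do rewrite sub0r.
- move=> /(ae_eq_reflect 0) h; apply: g0; move: h.
  by under eq_fun do rewrite sub0r opprK.
- by move=> a b z k; exact: stft_tfs_opp.
Qed.

Lemma stftZ g f (c : R[i]) z : L2 g -> L2 f ->
  stft g (fun t => c * f t) z = c * stft g f z.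
Proof.
move=> L2g L2f; rewrite /stft -Rn_cintZ; last exact: cintegrable_stft.
by congr Rn_cint; apply/funext => t; ring.
Qed.

(** The exponent starts at 1: with exponent 0, the choices c = i and c = -i would give functions
    equal up to a phase. *)
Definition gen a b phi (c : R[i]) k : 'cV[R]_d -> R[i] :=
  fun t => phi t + c * iter k.+1 (tfs a b) phi t.

Lemma L2_gen a b phi c k : L2 phi -> L2 (gen a b phi c k).
Proof. by move=> L2p; apply: L2D => //; apply: L2Z; exact: L2_iter_tfs. Qed.

(** Equivalence would mean (1 - nu) phi - i (1 + nu) pi(w)^{k+1} phi = 0, and 1 - nu and 1 + nu are
    not both zero, against linear independence. *)
Lemma gen_not_equiv a b phi (kappa : R) k : L2 phi -> ~ Defs.ae_eq phi (fun=> 0) ->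
  (a != 0) || (b != 0) -> kappa != 0 ->
  ~ equiv_phase (fun t => kappa%:C%C * gen a b phi (- 'i%C) k t)
                (fun t => kappa%:C%C * gen a b phi 'i%C k t).
Proof.
move=> L2p p0 ab0 kap0 [nu [_ [N [mN N0 fN]]]]; apply: p0.
pose c j : R[i] := if j is j'.+1 then (if j' == k then - 'i%C * (1 + nu) else 0) else 1 - nu.
have [j jk cj] : exists2 j, (j < k.+2)%N & c j != 0.
  have [n1|n1] := eqVneq nu 1; last first.
    by exists 0%N => //; rewrite /c subr_eq0 eq_sym.
  exists k.+1 => //; rewrite /c eqxx n1; apply: mulf_neq0.
    by rewrite oppr_eq0 eq_complex /= oner_eq0 andbF.
  by rewrite -mulr2n pnatr_eq0.
apply: (iter_tfs_free L2p ab0 jk cj); exists N; split=> // t Nt.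
rewrite big_ord_recl big_ord_recr big1 /= => [|i _]; last first.
  by rewrite add0n ltn_eqF ?mul0r.
rewrite add0n eqxx add0r; have := fN t Nt; rewrite /gen /=.
set u := phi t; set v := tfs _ _ _ _ => e.
have kC : kappa%:C%C != 0 by rewrite eq_complex /= eqxx andbT.
apply: (mulfI kC); rewrite mulr0; move/eqP: e; rewrite -subr_eq0 => /eqP e.
by rewrite -[RHS]e; ring.
Qed.

(** Let A and B be the transforms at z of phi and of its iterate. Both satisfy A = e conj(A), B = e
    conj(B) with the same unimodular e, which depends on z only. Hence |A - i B| = |conj(A) - i
    conj(B)| = |conj(A + i B)| = |A + i B|. *)
Lemma gen_same_modulus g a b phi (kappa : R) k (z : 'cV[R]_(d + d)) (m : int) :
  L2 g -> L2 phi ->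
  (forall a b (z : 'cV[R]_(d + d)) (k : int),
    dotR b (usubmx z) - dotR a (dsubmx z) = k%:~R ->
    stft g (tfs a b phi) z = expi (- (2 * pi * dotR (dsubmx z) (usubmx z))) *
      conjc (stft g (tfs a b phi) z)) ->
  dotR b (usubmx z) - dotR a (dsubmx z) = m%:~R ->
  `|stft g (fun t => kappa%:C%C * gen a b phi 'i%C k t) z| =
  `|stft g (fun t => kappa%:C%C * gen a b phi (- 'i%C) k t) z|.
Proof.
move=> L2g L2p sym abz.
have symk j : stft g (iter j (tfs a b) phi) z =
    expi (- (2 * pi * dotR (dsubmx z) (usubmx z))) * conjc (stft g (iter j (tfs a b) phi) z).
  (* The multiple j w has phase j m, still an integer; j = 0 covers phi itself. *)
  rewrite iter_tfs; apply: (sym _ _ _ (m *+ j)).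
  by rewrite !dotRZl -mulrBr abz rmorphMn /= mulr_natl.
rewrite !stftZ//; [|exact: L2_gen..]; rewrite !normrM; congr (_ * _).
rewrite !stft_lin//; [|exact: L2_iter_tfs..].
rewrite !sqmod_normc; congr (_%:C)%C; congr Num.sqrt.
rewrite [in RHS](symk k.+1) [in RHS](symk 0%N : stft g phi z = _) mulrCA -mulrDr.
rewrite sqmodM sqmod_expi mul1r -[LHS]sqmod_conjc; congr sqmod.
by apply: complex_eqP; rewrite ?(Re_conjc, Im_conjc, ReD, ImD, ReM, ImM) /=; ring.
Qed.

(** If m functions spanned all generators, m + 1 of these would satisfy a nontrivial relation, hence
    so would the iterates of phi. *)
Lemma gen_infinite_dim a b phi m (u : 'I_m -> 'cV[R]_d -> R[i]) : L2 phi ->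
  ~ Defs.ae_eq phi (fun=> 0) -> (a != 0) || (b != 0) ->
  exists k, ~ exists c : 'I_m -> R[i],
    Defs.ae_eq (gen a b phi 'i%C k) (fun t => \sum_(i < m) c i * u i t).
Proof.
move=> L2p p0 ab0; apply: contrapT => /forallNP h.
have {}h k : exists c : 'I_m -> R[i],
    Defs.ae_eq (gen a b phi 'i%C k) (fun t => \sum_(i < m) c i * u i t).
  by have /contrapT := h k.
have {h}[c hc] := choice h; apply: p0.
pose M : 'M[R[i]]_(m.+1, m) := \matrix_(j, i) c j i.
(* A matrix with m + 1 rows and m columns has a nonzero left kernel. *)
have : kermx M != 0.
  by rewrite -mxrank_eq0 mxrank_ker -lt0n subn_gt0 ltnS rank_leq_col.
case/rowV0Pn => v /sub_kermxP vM v0.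
have [j0 vj0] : exists j, v ord0 j != 0.
  apply: contrapT => hv; move/eqP: v0; apply; apply/rowP => j; rewrite mxE.
  by apply: contrapT => /eqP vj; apply: hv; exists j.
(* The relation rewritten in the iterates: every generator contributes to index 0, and only the
   generator of index k' to index k' + 1. *)
pose e k : R[i] := if k is k'.+1 then 'i%C * v ord0 (inord k') else \sum_j v ord0 j.
have ej0 : e j0.+1 != 0.
  rewrite /e inord_val mulf_neq0//.
  by rewrite eq_complex /= oner_eq0 andbF.
apply: (iter_tfs_free L2p ab0 (_ : (j0.+1 < m.+2)%N) ej0); first by rewrite ltnS.
apply/ae_eqP.
have : {ae Rn_measure R d, forall t, forall j : 'I_m.+1,
    gen a b phi 'i%C j (cV_of_tuple t) = \sum_(i < m) c j i * u i (cV_of_tuple t)}.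
  by apply: filter_forall => j; have /ae_eqP := hc j.
apply: filterS => t ht.
transitivity (\sum_j v ord0 j * gen a b phi 'i%C j (cV_of_tuple t)).
  rewrite big_ord_recl /= mulr_suml -big_split; apply: eq_bigr => j _.
  by rewrite /gen /bump /= ?add0n inord_val; ring.
under eq_bigr do rewrite ht mulr_sumr.
rewrite exchange_big big1// => i _.
under eq_bigr do rewrite mulrA; rewrite -mulr_suml.
have /rowP/(_ i) := vM; rewrite !mxE; under eq_bigr do rewrite mxE.
by move=> ->; rewrite mul0r.
Qed.

End main.

Theorem theorem1p3 (R : realType) (d : nat) (hd : (0 < d)%N)
  (g : 'cV[R]_d -> R[i]) (hg : L2 g)
  (L : set 'cV[R]_(d + d)) (S : 'M[R]_(d + d)) (Lam : set 'cV[R]_d)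
  (hS : symplectic S) (hLam : is_lattice Lam)
  (hL : L `<=` [set S *m col_mx x lam | x in [set: 'cV[R]_d] & lam in Lam]) :
  exists C : set ('cV[R]_d -> R[i]),
    [/\ is_cone C, infinite_dimensional C & C `<=` Nset g L].
Proof.
have [k0 k0_neq0 k0P] := exists_dual_vector hd hLam.
(* Against a point S(x, lam), the symplectic form of w is -k0.lam, an integer; this explains the
   [- m] at the end. *)
pose w := S *m col_mx k0 0; pose a := usubmx w; pose b := dsubmx w.
have ab0 : (a != 0) || (b != 0).
  rewrite -negb_and; apply: contra k0_neq0 => /andP[/eqP a0 /eqP b0].
  have w0 : w = 0 by rewrite -(vsubmxK w) -/a -/b a0 b0 col_mx0.
  have [uS _] := hS; have := mulKmx uS (col_mx k0 0); rewrite -/w w0 mulmx0.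
  by move/(congr1 usubmx); rewrite col_mxKu linear0 => <-.
have [phi [L2p p0 sym]] := exists_generator hg.
(* The union of the open rays through the generators. The partner of each function is obtained by
   changing i into -i. *)
exists [set f | exists kappa : R, exists k, 0 < kappa /\
  f = (fun t => kappa%:C%C * gen a b phi 'i%C k t)]; split.
- move=> r f r0 [kap [k [kap0 ->]]]; exists (r * kap), k; split; first exact: mulr_gt0.
  by apply/funext => t; rewrite rmorphM mulrA.
- move=> m u _; have [k hk] := @gen_infinite_dim R d a b phi m u L2p p0 ab0.
  exists (gen a b phi 'i%C k) => //; exists 1, k; split=> //.
  by apply/funext => t; rewrite rmorph1 mul1r.
- move=> _ [kap [k [kap0 ->]]]; split; first by apply: L2Z; exact: L2_gen.
  exists (fun t => kap%:C%C * gen a b phi (- 'i%C) k t); split.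
  + by apply: L2Z; exact: L2_gen.
  + by apply: gen_not_equiv => //; rewrite gt_eqF.
  + move=> z Lz; have [x _ [lam lamL zE]] := hL z Lz.
    have [m mE] := k0P lam lamL.
    apply: (@gen_same_modulus R d g a b phi kap k z (- m)) => //.
    by rewrite -zE (symplectic_phase k0 x lam hS) mE rmorphN.
Qed.
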